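(* Every graph limit $\Gamma\in\mathcal U_\infty$ can be written as a finite or infinite direct sum $\Gamma=\bigoplus_{i=1}^M\alpha_i\Gamma_i$ for some $M$ with $0\le M\le\infty$ and some sequences $(\Gamma_i)_{i=1}^M$ and $(\alpha_i)_{i=1}^M$ with every $\Gamma_i\in\mathcal U_\infty$ connected, every $\alpha_i>0$, and $\sum_{i=1}^M\alpha_i\le 1$. The number $M$ and the sequences $(\Gamma_i)_{i=1}^M$ and $(\alpha_i)_{i=1}^M$ are uniquely determined by $\Gamma$, up to simultaneous permutations of the two sequences. The set of components of $\Gamma$ equals $\{\Gamma_i\}_{i=1}^M$, i.e., a graph limit $\Gamma'$ is a component of $\Gamma$ if and only if $\Gamma'=\Gamma_i$ for some $i$.
   Context: Graphs are finite, simple, undirected, with at least one vertex; $v(G)=|V(G)|$, $e(G)=|E(G)|$. Graph limits. For graphs $F,G$, $t(F,G)$ is the probability that a uniformly random map $V(F)\to V(G)$ is a graph homomorphism (maps edges to edges). The set $\mathcal U$ of unlabelled graphs (isomorphism classes) is embedded as a dense subset of a compact metric space $\overline{\mathcal U}$; the elements of $\mathcal U_\infty=\overline{\mathcal U}\setminus\mathcal U$ are called graph limits, and $v(\Gamma)=\infty$ for $\Gamma\in\mathcal U_\infty$. Each $t(F,\cdot)$ extends continuously to $\overline{\mathcal U}$; a graph limit $\Gamma$ is determined by the numbers $t(F,\Gamma)$, $F$ ranging over all graphs; and a sequence $G_n$ in $\overline{\mathcal U}$ converges to $\Gamma\in\mathcal U_\infty$ iff $v(G_n)\to\infty$ and $t(F,G_n)\to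 t(F,\Gamma)$ for every graph $F$. (Concretely, graph limits can be identified with the families $(t_F)_F$ arising as $t_F=\lim_n t(F,G_n)$ for sequences of graphs with $v(G_n)\to\infty$ for which all these limits exist.) Direct sums. For $0\le m\le\infty$, graph limits $(\Gamma_i)_{i=1}^m$ and weights $\alpha_i\ge0$ with $\sum_{i=1}^m\alpha_i\le1$, the direct sum $\bigoplus_{i=1}^m\alpha_i\Gamma_i$ is the unique graph limit $\Gamma$ with $t(F,\Gamma)=\sum_{i=1}^m\alpha_i^{v(F)}t(F,\Gamma_i)$ for every connected graph $F$ with at least one edge. For $m=2$ and weights $\alpha,1-\alpha$ it is written $\alpha\Gamma_1\oplus(1-\alpha)\Gamma_2$. For $m=0$ the direct sum is the trivial graph limit $\mathbf 0$, with $t(F,\mathbf 0)=0$ if $e(F)\ge1$ and $1$ if $e(F)=0$. Connectedness. A graph limit $\Gamma$ is disconnected if there exist $\Gamma_1,\Gamma_2\in\mathcal U_\infty$ and $\alpha\in(0,1)$ with $\Gamma=\alpha\Gamma_1\oplus(1-\alpha)\Gamma_2$; otherwise it is connected. A component of $\Gamma$ is a connected graph limit $\Gamma_1$ such that $\Gamma=\alpha\Gamma_1\oplus(1-\alpha)\Gamma_2$ for some $\alpha\in(0,1]$ and $\Gamma_2\in\mathcal U_\infty$. *)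

(* Defs.v *)
From HB Require Import structures.
From mathcomp Require Import all_boot all_order all_algebra.
From mathcomp Require Import all_classical all_reals all_analysis.
Import Order.TTheory GRing.Theory Num.Theory.
Import numFieldNormedType.Exports.

Set Implicit Arguments.
Unset Strict Implicit.
Unset Printing Implicit Defensive.

Local Open Scope classical_set_scope.
Local Open Scope ring_scope.

(* Graphs are considered up to isomorphism, so that their vertex sets can be
   taken of the form 'I_n. *)
Record graph := Graph {
  nverts : nat;
  adj : 'I_nverts -> 'I_nverts -> bool;
  adj_sym : symmetric adj;
  adj_irrefl : irreflexive adj;
  nverts_gt0 : (0 < nverts)%N }.

Definition connected_graph (F : graph) : Prop :=
  forall x y : 'I_(nverts F), connect (@adj F) x y.

Definition has_edge (F : graph) : Prop :=
  exists x y : 'I_(nverts F), adj x y.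

Definition is_hom (F G : graph) (f : {ffun 'I_(nverts F) -> 'I_(nverts G)}) : bool :=
  [forall x, forall y, adj x y ==> adj (f x) (f y)].

Definition hom_density (R : realType) (F G : graph) : R :=
  #|[pred f : {ffun 'I_(nverts F) -> 'I_(nverts G)} | is_hom f]|%:R /
  #|{ffun 'I_(nverts F) -> 'I_(nverts G)}|%:R.

(* A graph limit is represented by its family of densities t(F, -), which
   determines it; the families that occur are the pointwise limits of
   t(F, G_n) along sequences of graphs with v(G_n) -> oo. *)
Definition is_graph_limit (R : realType) (t : graph -> R) : Prop :=
  exists G : nat -> graph,
    (fun n => nverts (G n)) @ \oo --> \oo /\
    forall F : graph, (fun n => hom_density R F (G n)) @ \oo --> t F.

Record graph_limit (R : realType) := GraphLimit {
  density :> graph -> R;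
  density_limit : is_graph_limit density }.

(* Index set of a sequence of length M, where None stands for M = oo; the
   indices start at 0. *)
Definition seq_index (M : option nat) : choiceType :=
  match M with Some m => 'I_m | None => nat end.

(* "Gamma is the direct sum of the alpha_i Gamma_i", for weights alpha_i >= 0 of
   total at most 1. The terms are then nonnegative, so that \esum is the usual
   sum of the (finite or infinite) series. *)
Definition is_direct_sum (R : realType) (M : option nat)
    (alpha : seq_index M -> R) (Gammas : seq_index M -> graph_limit R)
    (Gamma : graph_limit R) : Prop :=
  forall F : graph, connected_graph F -> has_edge F ->
    (Gamma F)%:E =
      \esum_(i in [set: seq_index M]) (alpha i ^+ nverts F * Gammas i F)%:E.

Definition is_direct_sum2 (R : realType) (a : R)
    (Gamma1 Gamma2 Gamma : graph_limit R) : Prop :=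
  @is_direct_sum R (Some 2%N) (tnth [tuple a; 1 - a])
    (tnth [tuple Gamma1; Gamma2]) Gamma.

Definition disconnected_limit (R : realType) (Gamma : graph_limit R) : Prop :=
  exists (Gamma1 Gamma2 : graph_limit R) (a : R),
    0 < a < 1 /\ is_direct_sum2 a Gamma1 Gamma2 Gamma.

Definition connected_limit (R : realType) (Gamma : graph_limit R) : Prop :=
  ~ disconnected_limit Gamma.

Definition is_component (R : realType) (Gamma Gamma1 : graph_limit R) : Prop :=
  connected_limit Gamma1 /\
  exists (a : R) (Gamma2 : graph_limit R),
    0 < a <= 1 /\ is_direct_sum2 a Gamma1 Gamma2 Gamma.

Definition is_connected_decomposition (R : realType) (Gamma : graph_limit R)
    (M : option nat) (alpha : seq_index M -> R)
    (Gammas : seq_index M -> graph_limit R) : Prop :=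
  [/\ forall i, connected_limit (Gammas i),
      forall i, 0 < alpha i,
      (\esum_(i in [set: seq_index M]) (alpha i)%:E <= 1)%E &
      is_direct_sum alpha Gammas Gamma].

(* Main.v *)
Require Import Defs.
From mathcomp Require Import all_boot all_order all_algebra.
From mathcomp Require Import all_classical all_reals all_analysis.
From mathcomp Require Import ring lra zify.
Import Order.TTheory GRing.Theory Num.Theory.
Import numFieldNormedType.Exports.

(** A graph limit is known only through its densities, so the proof works with
finite graphs that approximate it.

Existence. Among the decompositions of Gamma as a direct sum, consider one that
minimises the sum of the squared weights. If one of its parts of positive weight
were disconnected, splitting this part would lower the sum; hence the parts are
connected (minimal_decomposition). A minimiser exists by compactness: once the
weights are sorted, the k-th one is at most 1 / (k + 1), so the tails of all
decompositions are uniformly small and a limit of decompositions is a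
decomposition (sorted_decomposition, limit_decomposition). Limits are taken along
an ultrafilter, so that all densities converge simultaneously.

Uniqueness. The law of a random sample of k vertices of a large graph is
determined in the limit by the homomorphism densities (pattern_prob_cvg). A
decomposition of Gamma yields large weighted graphs converging to Gamma that are
disjoint unions of graphs close to its parts (decomposition_limit), and by a
second moment computation a sample of them inherits this structure with high
probability (sample_dens_concentrated). Given two decompositions, samples of the
corresponding graphs have almost the same law, so some graph S is a typical
sample of both: its vertices carry two labellings, one by the parts of each
decomposition, and no edge joins different labels (overlay). If Gamma_i is
connected, each label j of the second labelling fills either almost all or almost
nothing of the class i, for otherwise restricting to the two sides of this cut
and taking limits would split Gamma_i (connected_cut). It cannot be that every j
fills almost nothing, as then all densities of Gamma_i would vanish
(overlap_exists). Thus each class of the first labelling almost coincides with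
exactly one class of the second, and conversely; such classes have the same mass
and the same limit (matching).

Components. A component is a connected part of a decomposition in two parts, so
matching identifies it with some Gamma_i. Conversely, removing the class i from
graphs that approximate Gamma leaves graphs whose limit is a complement of
Gamma_i (component_complement). *)

Set Implicit Arguments.
Unset Strict Implicit.
Unset Printing Implicit Defensive.

Local Open Scope classical_set_scope.
Local Open Scope ring_scope.

(** * Random maps on finite sets *)

Section Expectation.
Context {R : realType}.

Definition expect (V T : finType) (w : T -> R) (h : {ffun V -> T} -> R) : R :=
  \sum_(f : {ffun V -> T}) (\prod_v w (f v)) * h f.

(** Precomposition by p; it turns a random map on V into a random map on U. *)
Definition pullback (U V T : finType) (p : {ffun U -> V}) (f : {ffun V -> T}) :
  {ffun U -> T} := [ffun u => f (p u)].

Lemma eq_expect (V T : finType) (w : T -> R) (h h' : {ffun V -> T} -> R) :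
  h =1 h' -> expect w h = expect w h'.
Proof. by move=> e; apply: eq_bigr => f _; rewrite e. Qed.

Lemma expectD (V T : finType) (w : T -> R) (h h' : {ffun V -> T} -> R) :
  expect w (fun f => h f + h' f) = expect w h + expect w h'.
Proof. by rewrite /expect -big_split; apply: eq_bigr => f _; rewrite mulrDr. Qed.

Lemma expectZ (V T : finType) (w : T -> R) (c : R) (h : {ffun V -> T} -> R) :
  expect w (fun f => c * h f) = c * expect w h.
Proof. by rewrite /expect mulr_sumr; apply: eq_bigr => f _; rewrite mulrCA. Qed.

Lemma expect_sum (V T I : finType) (w : T -> R) (P : pred I)
    (h : I -> {ffun V -> T} -> R) :
  expect w (fun f => \sum_(i | P i) h i f) = \sum_(i | P i) expect w (h i).
Proof.
by rewrite /expect exchange_big; apply: eq_bigr => f _; rewrite mulr_sumr.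
Qed.

Lemma expect_sum_seq (V T : finType) (I : Type) (w : T -> R) (r : seq I)
    (h : I -> {ffun V -> T} -> R) :
  expect w (fun f => \sum_(i <- r) h i f) = \sum_(i <- r) expect w (h i).
Proof.
by rewrite /expect exchange_big; apply: eq_bigr => f _; rewrite mulr_sumr.
Qed.

Lemma ler_expect (V T : finType) (w : T -> R) (h h' : {ffun V -> T} -> R) :
  (forall x, 0 <= w x) -> (forall f, h f <= h' f) -> expect w h <= expect w h'.
Proof.
by move=> w0 le_h; apply: ler_sum => f _; rewrite ler_wpM2l ?prodr_ge0.
Qed.

Lemma expect_ge0 (V T : finType) (w : T -> R) (h : {ffun V -> T} -> R) :
  (forall x, 0 <= w x) -> (forall f, 0 <= h f) -> 0 <= expect w h.
Proof. by move=> w0 h0; apply: sumr_ge0 => f _; rewrite mulr_ge0 ?prodr_ge0. Qed.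

Lemma expect_cst (V T : finType) (w : T -> R) (c : R) :
  \sum_x w x = 1 -> expect w (fun _ : {ffun V -> T} => c) = c.
Proof.
move=> w1; rewrite /expect -mulr_suml -(bigA_distr_bigA (fun _ x => w x)) /=.
by rewrite big1 ?mul1r.
Qed.

(** Restricting a random map to the image of an injection gives a random map
again: the remaining coordinates integrate to 1. *)
Lemma expect_pullback (U V T : finType) (w : T -> R) (p : {ffun U -> V})
    (h : {ffun U -> T} -> R) :
  \sum_x w x = 1 -> injective p ->
  expect w (fun f : {ffun V -> T} => h (pullback p f)) = expect w h.
Proof.
move=> w1 p_inj; rewrite /expect.
rewrite (partition_big (pullback p) predT) //=; apply: eq_bigr => g _.
rewrite (eq_bigr (fun f : {ffun V -> T} => (\prod_v w (f v)) * h g)); last first.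
  by move=> f /= /eqP ->.
rewrite -mulr_suml; congr (_ * _).
pose Q v x := [forall u, (p u == v) ==> (x == g u)].
rewrite (eq_bigl (mem (family Q))); last first.
  move=> f; apply/eqP/familyP => /= [fg v | fQ].
    by apply/forallP => u; apply/implyP => /eqP <-; rewrite -fg ffunE.
  apply/ffunP => u; rewrite ffunE.
  by have := fQ (p u) => /forallP/(_ u); rewrite eqxx /= => /eqP.
rewrite -(bigA_distr_big_dep (fun v x => Q v x) (fun v x => w x)).
rewrite (bigID (mem (codom p))) /= [X in _ * X]big1 ?mulr1; last first.
  move=> v v_p; rewrite -w1; apply: eq_bigl => x; apply/forallP => u.
  by apply/implyP => /eqP pu; rewrite -pu codom_f in v_p.
rewrite (eq_bigl (mem [set p u | u in predT])%SET); last first.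
  by move=> v; apply/codomP/imsetP => [[u ->]|[u _ ->]]; exists u.
rewrite (big_imset _ (in2W p_inj)) /=; apply: eq_bigr => u _.
rewrite (big_pred1 (g u)) // => x; apply/forallP/eqP => [/(_ u)|-> u'].
  by rewrite eqxx => /eqP.
by apply/implyP => /eqP/p_inj ->.
Qed.

(** The values of a random map are independent, so its restrictions to the two
parts of a disjoint union can be averaged separately. *)
Lemma expect_sumT (U V T : finType) (w : T -> R) (g : {ffun U -> T} -> R)
    (h : {ffun V -> T} -> R) :
  expect w (fun f : {ffun U + V -> T} =>
    g (pullback [ffun u => inl u] f) * h (pullback [ffun v => inr v] f)) =
  expect w g * expect w h.
Proof.
rewrite /expect big_distrlr /= pair_big /=.
pose glue (f : {ffun U -> T} * {ffun V -> T}) : {ffun U + V -> T} :=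
  [ffun z => match z with inl u => f.1 u | inr v => f.2 v end].
pose split (f : {ffun U + V -> T}) : {ffun U -> T} * {ffun V -> T} :=
  (pullback [ffun u => inl u] f, pullback [ffun v => inr v] f).
rewrite (reindex glue); last first.
  exists split => [[f1 f2]|f] _.
    by congr pair; apply/ffunP => x; rewrite !ffunE.
  by apply/ffunP => -[] x; rewrite !ffunE.
apply: eq_bigr => -[f1 f2] _ /=; rewrite big_sumType /=.
have -> : pullback [ffun u => inl u] (glue (f1, f2)) = f1.
  by apply/ffunP => x; rewrite !ffunE.
have -> : pullback [ffun v => inr v] (glue (f1, f2)) = f2.
  by apply/ffunP => x; rewrite !ffunE.
under eq_bigr do rewrite ffunE /=.
under [X in _ * X * _ = _]eq_bigr do rewrite ffunE /=.
ring.
Qed.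

(** Of the k ^ n maps from n points to k points, at least a proportion
1 - n ^ 2 / k is injective: each step of the induction loses at most n / k. *)
Lemma ffact_ge (n k : nat) : (0 < k)%N ->
  (k ^ n)%:R * (1 - (n ^ 2)%:R / k%:R) <= (k ^_ n)%:R :> R.
Proof.
move=> k0; have k0' : 0 < k%:R :> R by rewrite ltr0n.
elim: n => [|n IH]; first by rewrite expn0 ffactn0 mul0r subr0 mulr1.
have [nk|kn] := leqP n k; last first.
  apply: le_trans (ler0n _ _); rewrite mulr_ge0_le0 ?ler0n // subr_le0.
  rewrite ler_pdivlMr // mul1r ler_nat; apply: leq_trans (leq_pmulr _ _) => //.
  exact: leqW (ltnW kn).
rewrite ffactnSr natrM natrB // expnSr natrM.
have le1 : (k ^_ n)%:R <= (k ^ n)%:R :> R.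
  rewrite ler_nat; elim: {IH} n nk => [|n IH] nk; first by rewrite ffactn0.
  by rewrite ffactnSr expnSr leq_mul ?leq_subr // IH // ltnW.
have -> : (k ^ n)%:R * k%:R * (1 - (n.+1 ^ 2)%:R / k%:R) =
   (k ^ n)%:R * (1 - (n ^ 2)%:R / k%:R) * k%:R - (k ^ n)%:R * (2 * n%:R + 1) :> R.
  by rewrite -[in LHS]addn1 !natrX natrD; field; rewrite gt_eqF.
rewrite [X in _ <= X]mulrBr; apply: lerD; first by rewrite ler_pM2r.
rewrite lerN2 ler_pM ?ler0n //.
by have : 0 <= n%:R :> R := ler0n _ _; lra.
Qed.

Definition unif_weight (n : nat) : 'I_n -> R := fun=> n%:R^-1.

Lemma expect_unif_noninj (V : finType) (k : nat) : (0 < k)%N ->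
  expect (@unif_weight k) (fun f : {ffun V -> 'I_k} => (~~ injectiveb f)%:R)
    <= (#|V| ^ 2)%:R / k%:R.
Proof.
move=> k0; have k0' : 0 < k%:R :> R by rewrite ltr0n.
rewrite /expect /unif_weight /=.
have -> : \prod_(v : V) (k%:R^-1 : R) = k%:R^-1 ^+ #|V|.
  by rewrite -prodr_const; apply: eq_bigl.
rewrite -mulr_sumr.
have -> : \sum_(f : {ffun V -> 'I_k}) (~~ injectiveb f)%:R =
    #|[pred f : {ffun V -> 'I_k} | ~~ injectiveb f]|%:R :> R.
  rewrite -sum1_card natr_sum [RHS]big_mkcond; apply: eq_bigr => f _.
  by rewrite inE; case: injectiveb.
have := card_inj_ffuns V 'I_k; rewrite card_ord => inj.
have := cardsC [set f : {ffun V -> 'I_k} | injectiveb f]%SET.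
rewrite inj card_ffun card_ord => tot.
have -> : #|[pred f : {ffun V -> 'I_k} | ~~ injectiveb f]| =
   #|(~: [set f : {ffun V -> 'I_k} | injectiveb f])%SET|.
  by apply: eq_card => f; rewrite !inE.
have := @ffact_ge #|V| k k0.
move: tot => /(congr1 (fun n => n%:R : R)); rewrite natrD => tot.
set c := #|_|%:R in tot *; move=> le.
have kn0 : 0 < (k ^ #|V|)%:R :> R by rewrite ltr0n expn_gt0 k0.
rewrite exprVn -natrX mulrC ler_pdivrMr //.
have -> : c = (k ^ #|V|)%:R - (k ^_ #|V|)%:R by rewrite -tot; ring.
move: le; rewrite mulrBr; lra.
Qed.

(** The empirical mean of h over the maps from V to a random sample s is almost
unbiased: a random map from V to the sample positions is injective up to
probability O(1/k), and then the sampled V-tuple is distributed as a random map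
from V to the population. *)
Lemma expect_sample_bias (V T : finType) (k : nat) (w : T -> R)
    (h : {ffun V -> T} -> R) :
  (0 < k)%N -> (forall x, 0 <= w x) -> \sum_x w x = 1 ->
  (forall f, 0 <= h f <= 1) ->
  `|expect w (fun s : {ffun 'I_k -> T} =>
      expect (@unif_weight k) (fun p : {ffun V -> 'I_k} => h (pullback p s)))
    - expect w h| <= (#|V| ^ 2)%:R / k%:R.
Proof.
move=> k0 w0 w1 h01; have k0' : 0 < k%:R :> R by rewrite ltr0n.
have u1 : \sum_x @unif_weight k x = 1.
  by rewrite sumr_const card_ord -[LHS]mulr_natr mulVf // gt_eqF.
have u0 x : 0 <= @unif_weight k x by rewrite invr_ge0 ler0n.
have eh01 : 0 <= expect w h <= 1.
  rewrite expect_ge0 => [|//|f]; last by case/andP: (h01 f).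
  rewrite -[leRHS](@expect_cst V T w 1) //; apply: ler_expect => // f.
  by case/andP: (h01 f).
have -> : expect w (fun s : {ffun 'I_k -> T} =>
      expect (@unif_weight k) (fun p : {ffun V -> 'I_k} => h (pullback p s))) =
    expect (@unif_weight k) (fun p : {ffun V -> 'I_k} =>
      expect w (fun s : {ffun 'I_k -> T} => h (pullback p s))).
  rewrite {1}/expect; under eq_bigr do rewrite mulr_sumr.
  rewrite exchange_big /=; apply: eq_bigr => p _.
  by rewrite mulr_sumr; apply: eq_bigr => s _; rewrite mulrCA.
rewrite -[X in _ - X](@expect_cst V _ (@unif_weight k) (expect w h)) //.
rewrite -mulN1r -expectZ -expectD.
apply: le_trans (expect_unif_noninj V k0).
apply: (@le_trans _ _ (expect (@unif_weight k) (fun p : {ffun V -> 'I_k} =>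
   `|expect w (fun s : {ffun 'I_k -> T} => h (pullback p s)) + -1 * expect w h|))).
  rewrite /expect; apply: le_trans (ler_norm_sum _ _ _) _.
  by apply: ler_sum => p _; rewrite normrM ger0_norm ?prodr_ge0.
apply: ler_expect => // p; have [p_inj|p_inj] := boolP (injectiveb p).
  by rewrite expect_pullback ?mulN1r ?subrr ?normr0 //; apply/injectiveP.
rewrite mulN1r /= ler_norml.
have : 0 <= expect w (fun s : {ffun 'I_k -> T} => h (pullback p s)) <= 1.
  rewrite expect_ge0 => [|//|f]; last by case/andP: (h01 (pullback p f)).
  rewrite -[leRHS](@expect_cst 'I_k T w 1) //; apply: ler_expect => // f.
  by case/andP: (h01 (pullback p f)).
lra.
Qed.

(** The square of an empirical mean over V-tuples is an empirical mean over
(V + V)-tuples, so that the previous lemma also controls the second moment. *)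
Lemma expect_sample_variance (V T : finType) (k : nat) (w : T -> R)
    (h : {ffun V -> T} -> R) :
  (0 < k)%N -> (forall x, 0 <= w x) -> \sum_x w x = 1 ->
  (forall f, 0 <= h f <= 1) ->
  expect w (fun s : {ffun 'I_k -> T} =>
      (expect (@unif_weight k) (fun p : {ffun V -> 'I_k} => h (pullback p s))
        - expect w h) ^+ 2) <= 6 * (#|V| ^ 2)%:R / k%:R.
Proof.
move=> k0 w0 w1 h01.
pose hh (f : {ffun V + V -> T}) : R :=
  h (pullback [ffun u => inl u] f) * h (pullback [ffun u => inr u] f).
have hh01 f : 0 <= hh f <= 1.
  case/andP: (h01 (pullback [ffun u => inl u] f)) => a0 a1.
  case/andP: (h01 (pullback [ffun u => inr u] f)) => b0 b1.
  by rewrite /hh mulr_ge0 //= mulr_ile1.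
have := expect_sample_bias k0 w0 w1 hh01.
have := expect_sample_bias k0 w0 w1 h01.
rewrite /hh expect_sumT card_sum.
set m := expect w h; pose X := fun s : {ffun 'I_k -> T} =>
  expect (@unif_weight k) (fun p : {ffun V -> 'I_k} => h (pullback p s)).
have -> : expect w (fun s : {ffun 'I_k -> T} => expect (@unif_weight k)
    (fun p : {ffun V + V -> 'I_k} =>
    h (pullback [ffun u => inl u] (pullback p s)) *
    h (pullback [ffun u => inr u] (pullback p s)))) =
   expect w (fun s => X s * X s).
  apply: eq_expect => s; rewrite -expect_sumT; apply: eq_expect => p.
  by congr (h _ * h _); apply/ffunP => u; rewrite !ffunE.
have -> : expect w (fun s => (X s - m) ^+ 2) =
    expect w (fun s => X s * X s) - 2 * m * expect w X + m ^+ 2.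
  rewrite -[m ^+ 2 in RHS](@expect_cst 'I_k _ w) // -mulNr -expectZ -!expectD.
  by apply: eq_expect => s; ring.
have m01 : 0 <= m <= 1.
  rewrite expect_ge0 => [|//|f]; last by case/andP: (h01 f).
  rewrite -[leRHS](@expect_cst V T w 1) //; apply: ler_expect => // f.
  by case/andP: (h01 f).
rewrite -/X !ler_norml.
set A := expect w _; set B := expect w X.
set c := (#|V| ^ 2)%:R / k%:R.
have -> : ((#|V| + #|V|) ^ 2)%:R / k%:R = 4 * c.
  by rewrite /c addnn -mul2n expnMn natrM mulrA.
have -> : 6 * (#|V| ^ 2)%:R / k%:R = 6 * c by rewrite /c mulrA.
have c0 : 0 <= c by rewrite divr_ge0 ?ler0n.
(* With X the empirical mean, the variance is at most the error 4 c on the mean of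
   X ^ 2 plus 2 m times the error c on the mean of X, where m <= 1. *)
move: (c) c0 m01 => d d0 /andP[m0 m1] /andP[b1 b2] /andP[a1 a2].
nra.
Qed.

Lemma expect_markov (V T : finType) (w : T -> R) (h : {ffun V -> T} -> R)
    (P : pred {ffun V -> T}) (e : R) :
  (forall x, 0 <= w x) -> (forall f, 0 <= h f) -> (forall f, P f -> e <= h f) ->
  e * expect w (fun f => (P f)%:R) <= expect w h.
Proof.
move=> w0 h0 hP; rewrite -expectZ; apply: ler_expect => // f.
by case: (boolP (P f)) => [/hP|_]; rewrite ?mulr1 ?mulr0.
Qed.
End Expectation.

(** * Homomorphism densities in weighted graphs *)

Section ExpectEmbed.
Context {R : realType}.

(** Maps with values in the image of an injection e are the maps e \o g. *)
Lemma expect_embed (V T T' : finType) (w : T -> R) (e : T' -> T) (P : pred T)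
    (h : {ffun V -> T} -> R) :
  injective e -> (forall x, P x = (x \in codom e)) ->
  expect w (fun f => [forall v, P (f v)]%:R * h f) =
  expect (fun x => w (e x)) (fun g : {ffun V -> T'} => h [ffun v => e (g v)]).
Proof.
move=> e_inj Pe; rewrite /expect.
pose E (g : {ffun V -> T'}) : {ffun V -> T} := [ffun v => e (g v)].
have E_inj : injective E.
  move=> g g' /ffunP Eg; apply/ffunP => v; apply: e_inj.
  by have := Eg v; rewrite !ffunE.
rewrite (bigID (mem [set E g | g in predT]%SET)) /= [X in _ + X]big1 ?addr0.
  rewrite (big_imset _ (in2W E_inj)) /=; apply: eq_bigr => g _.
  have -> : [forall v, P (E g v)].
    by apply/forallP => v; rewrite Pe ffunE codom_f.
  by rewrite mul1r; congr (_ * _); apply: eq_bigr => v _; rewrite ffunE.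
move=> f fE; case: (boolP [forall v, P (f v)]); last by rewrite !(mul0r, mulr0).
move=> /forallP Pf; case/imsetP: fE.
have ex v : exists x, e x == f v.
  by have := Pf v; rewrite Pe => /codomP [x ->]; exists x.
exists [ffun v => xchoose (ex v)] => //; apply/ffunP => v.
by rewrite !ffunE (eqP (xchooseP (ex v))).
Qed.

Lemma expect_scale (V T : finType) (c : R) (w : T -> R)
    (h : {ffun V -> T} -> R) :
  expect (fun x => c * w x) h = c ^+ #|V| * expect w h.
Proof.
rewrite /expect mulr_sumr; apply: eq_bigr => f _.
by rewrite big_split /= prodr_const mulrA.
Qed.
End ExpectEmbed.

Section WeightedGraph.
Context {R : realType}.

(** Weighted graphs are the populations from which graphs are sampled. Thanks to
the weights, a disjoint union can be given parts of arbitrary real masses,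
without rounding to numbers of vertices. *)
Record wgraph := WGraph {
  vertex : finType;
  edge : rel vertex;
  weight : vertex -> R;
  edge_sym : symmetric edge;
  edge_irrefl : irreflexive edge;
  weight_ge0 : forall x, 0 <= weight x;
  weight_sum : \sum_x weight x = 1 }.

Lemma unif_weight_ge0 n (x : 'I_n) : 0 <= unif_weight x :> R.
Proof. by rewrite invr_ge0 ler0n. Qed.

Lemma unif_weight_sum n : (0 < n)%N -> \sum_(x < n) unif_weight x = 1 :> R.
Proof.
move=> n0; rewrite sumr_const card_ord -[LHS]mulr_natr mulVf //.
by rewrite pnatr_eq0 -lt0n.
Qed.

Definition uniform (G : graph) : wgraph :=
  WGraph (@adj_sym G) (@adj_irrefl G) (@unif_weight_ge0 (nverts G))
    (unif_weight_sum (nverts_gt0 G)).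

Definition hom_in (F : graph) (T : finType) (e : rel T) (P : pred T)
    (f : {ffun 'I_(nverts F) -> T}) : bool :=
  [forall x, forall y, adj x y ==> e (f x) (f y)] && [forall x, P (f x)].

(** Density of the homomorphisms into the part of H cut out by P, normalised by
the whole of H: restricting to a part of mass c scales it by c ^+ nverts F. *)
Definition dens (F : graph) (H : wgraph) (P : pred (vertex H)) : R :=
  expect (@weight H) (fun f => (hom_in (F := F) (@edge H) P f)%:R).

Arguments dens F {H} P.

Definition mass (H : wgraph) (P : pred (vertex H)) : R := \sum_(x | P x) weight x.

Lemma hom_inP F (T : finType) (e : rel T) (P : pred T)
    (f : {ffun 'I_(nverts F) -> T}) :
  reflect ((forall x y, adj x y -> e (f x) (f y)) /\ forall x, P (f x))
    (hom_in e P f).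
Proof.
apply: (iffP andP) => -[h1 h2]; split.
- by move=> x y xy; move/forallP/(_ x)/forallP/(_ y)/implyP : h1; apply.
- by move=> x; move/forallP : h2; apply.
- by apply/forallP => x; apply/forallP => y; apply/implyP; apply: h1.
- by apply/forallP.
Qed.

Lemma hom_densityE F G : hom_density R F G = dens F (H := uniform G) predT.
Proof.
rewrite /hom_density /dens /expect /=.
have E (f : {ffun 'I_(nverts F) -> 'I_(nverts G)}) :
    \prod_v (unif_weight (f v) : R) =
    #|{ffun 'I_(nverts F) -> 'I_(nverts G)}|%:R^-1.
  rewrite card_ffun !card_ord natrX -exprVn -[in RHS](card_ord (nverts F)).
  by rewrite -prodr_const; apply: eq_bigl.
under [RHS]eq_bigr => f _ do rewrite E.
rewrite -mulr_sumr mulrC; congr (_ * _).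
rewrite -sum1_card natr_sum big_mkcond; apply: eq_bigr => f _.
rewrite !inE /is_hom /hom_in; set b := [forall x, _].
have -> : [forall x, predT (f x)] by apply/forallP.
by rewrite andbT; case: b.
Qed.

Lemma dens_ge0 F H P : 0 <= dens F (H := H) P.
Proof. by apply: expect_ge0 => // x; exact: weight_ge0. Qed.

Lemma dens_mono F H (P Q : pred (vertex H)) :
  (forall x, P x -> Q x) -> dens F P <= dens F Q.
Proof.
move=> PQ; apply: ler_expect => [x|f]; first exact: weight_ge0.
rewrite ler_nat; case: (boolP (hom_in _ P f)) => // /hom_inP [h1 h2].
by rewrite lt0n eqb0 negbK; apply/hom_inP; split => // x; exact/PQ/h2.
Qed.

Lemma eq_dens F H (P Q : pred (vertex H)) : P =1 Q -> dens F P = dens F Q.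
Proof.
by move=> PQ; apply/eqP; rewrite eq_le !dens_mono // => x; rewrite PQ.
Qed.

Lemma dens_le1 F H P : dens F (H := H) P <= 1.
Proof.
rewrite -[leRHS](@expect_cst R 'I_(nverts F) _ (@weight H)); last first.
  exact: weight_sum.
by apply: ler_expect => [x|f]; [exact: weight_ge0|rewrite lern1 leq_b1].
Qed.

Lemma dens_noedge F H : ~ has_edge F -> dens F (H := H) predT = 1.
Proof.
move=> F0; rewrite -[RHS](@expect_cst R 'I_(nverts F) _ (@weight H)); last first.
  exact: weight_sum.
apply: eq_expect => f; suff -> : hom_in (edge (w:=H)) predT f by [].
by apply/hom_inP; split => // x y xy; case: F0; exists x, y.
Qed.

Lemma mass_ge0 H P : 0 <= mass (H := H) P.
Proof. by apply: sumr_ge0 => x _; exact: weight_ge0. Qed.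

Lemma mass_expect H (P : pred (vertex H)) : mass P =
  expect (@weight H) (fun f : {ffun 'I_1 -> vertex H} => (P (f ord0))%:R).
Proof.
rewrite /expect /mass (reindex (fun x : vertex H => [ffun _ : 'I_1 => x])).
  rewrite [LHS]big_mkcond; apply: eq_bigr => x _.
  by rewrite big_ord1 !ffunE; case: (P x); rewrite ?mulr1 ?mulr0.
exists (fun f : {ffun 'I_1 -> _} => f ord0) => [x|f] _; rewrite ?ffunE //.
by apply/ffunP => i; rewrite ffunE (ord1 i).
Qed.

(** The image of one vertex of F already has to satisfy P. *)
Lemma dens_le_mass F H P : dens F (H := H) P <= mass P.
Proof.
pose p : {ffun 'I_1 -> 'I_(nverts F)} := [ffun _ => Ordinal (nverts_gt0 F)].
have p_inj : injective p by move=> x y _; rewrite !ord1.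
rewrite mass_expect -(expect_pullback _ (weight_sum H) p_inj).
apply: ler_expect => [x|f]; first exact: weight_ge0.
rewrite !ffunE ler_nat; case: (boolP (hom_in _ P f)) => // /hom_inP [h1 h2].
by rewrite h2.
Qed.

(** Through the graph with one vertex, masses are a special case of densities. *)
Definition vertex_graph : graph :=
  @Graph 1 (fun _ _ => false) (fun _ _ => erefl) (fun _ => erefl) isT.

Lemma dens_vertex_graph H P : dens vertex_graph (H := H) P = mass P.
Proof.
rewrite mass_expect; apply: eq_expect => f; congr (nat_of_bool _)%:R.
by apply/hom_inP/idP => [[_]|Pf]; [exact|split=> // x; rewrite (ord1 x)].
Qed.

(** If P is a copy of G on which the mass c is spread evenly, homomorphisms into
P are homomorphisms into G with all weights multiplied by c. *)
Lemma dens_embed F H G (P : pred (vertex H)) (c : R)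
    (e : 'I_(nverts G) -> vertex H) :
  injective e -> (forall x, P x = (x \in codom e)) ->
  (forall x y, edge (e x) (e y) = adj x y) ->
  (forall x, weight (e x) = c * (nverts G)%:R^-1) ->
  dens F P = c ^+ nverts F * hom_density R F G.
Proof.
move=> e_inj Pe adj_e we.
rewrite hom_densityE /dens -[in c ^+ _](card_ord (nverts F)) -expect_scale.
have -> : expect (weight (w:=H)) (fun f => (hom_in (F := F) (@edge H) P f)%:R) =
   expect (weight (w:=H)) (fun f : {ffun 'I_(nverts F) -> _} =>
      [forall v, P (f v)]%:R * (hom_in (@edge H) predT f)%:R).
  apply: eq_expect => f; rewrite -natrM mulnb; congr (nat_of_bool _)%:R.
  apply/hom_inP/andP => [[h1 h2]|[/forallP h2 /hom_inP [h1 _]]] //.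
  by split; [exact/forallP|exact/hom_inP].
rewrite (expect_embed _ _ e_inj Pe) /expect; apply: eq_bigr => g _ /=.
congr (_ * _); first by apply: eq_bigr => v _; rewrite we.
congr (nat_of_bool _)%:R; apply/hom_inP/hom_inP => -[h1 _]; split=> // x y /h1.
  by rewrite !ffunE adj_e.
by rewrite !ffunE adj_e.
Qed.

Definition induced (G : graph) (A : pred 'I_(nverts G)) (A0 : (0 < #|A|)%N) :
  graph := @Graph #|A| (fun x y => adj (enum_val x) (enum_val y))
    (fun x y => adj_sym _ _) (fun x => adj_irrefl _) A0.

Lemma mass_uniform G (A : pred 'I_(nverts G)) :
  mass (H := uniform G) A = #|A|%:R / (nverts G)%:R.
Proof. by rewrite /mass /= sumr_const -[LHS]mulr_natl. Qed.

Lemma dens_induced F G (A : pred 'I_(nverts G)) (A0 : (0 < #|A|)%N) :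
  dens F (H := uniform G) A =
  mass (H := uniform G) A ^+ nverts F * hom_density R F (induced A0).
Proof.
apply: (@dens_embed F (uniform G) (induced A0) A _ enum_val) => //.
- exact: enum_val_inj.
- move=> x; apply/idP/codomP => [xA|[y ->]]; last exact: enum_valP.
  by exists (enum_rank_in xA x); rewrite enum_rankK_in.
- move=> x; rewrite mass_uniform /= /unif_weight mulrAC divff ?mul1r //.
  by rewrite pnatr_eq0 -lt0n.
Qed.

(** A connected component of F and its complement are mapped independently. *)
Lemma dens_disconnected F : ~ connected_graph F ->
  exists F1 F2 : graph,
    [/\ (nverts F1 < nverts F)%N, (nverts F2 < nverts F)%N &
      forall H, dens F (H := H) predT = dens F1 (H := H) predT * dens F2 (H := H) predT].
Proof.
move=> /existsNP [x /existsNP [y /negP xy]].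
pose A : pred 'I_(nverts F) := [pred z | connect (@adj F) x z].
have Ax : x \in A by exact: connect0.
have By : y \in predC A by [].
have A0 : (0 < #|A|)%N by apply/card_gt0P; exists x.
have B0 : (0 < #|predC A|)%N by apply/card_gt0P; exists y.
have cAB : (#|A| + #|predC A| = nverts F)%N.
  by rewrite -[RHS]card_ord -(cardC A); congr addn; apply: eq_card.
have ltA : (#|A| < nverts F)%N by rewrite -[X in (_ < X)%N]cAB -addn1 leq_add2l.
have ltB : (#|predC A| < nverts F)%N by rewrite -[X in (_ < X)%N]cAB -add1n leq_add2r.
exists (induced A0), (induced B0); split; [exact: ltA|exact: ltB|move=> H].
pose p : {ffun 'I_#|A| + 'I_#|predC A| -> 'I_(nverts F)} :=
  [ffun z => match z with inl u => enum_val u | inr v => enum_val v end].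
have p_inj : injective p.
  move=> [u|u] [v|v]; rewrite !ffunE => uv.
  - by rewrite (enum_val_inj uv).
  - by have : enum_val v \notin A := enum_valP v; rewrite -uv enum_valP.
  - by have : enum_val u \notin A := enum_valP u; rewrite uv enum_valP.
  - by rewrite (enum_val_inj uv).
rewrite /dens -expect_sumT -(expect_pullback _ (weight_sum H) p_inj).
apply: eq_expect => f; rewrite -natrM mulnb; congr (nat_of_bool _)%:R.
have adjA u v : adj u v -> (u \in A) = (v \in A).
  move=> uv; rewrite !inE; apply/idP/idP => xu.
    exact: connect_trans xu (connect1 uv).
  by apply: connect_trans xu (connect1 _); rewrite adj_sym.
apply/hom_inP/andP => [[h _]|[/hom_inP [h1 _] /hom_inP [h2 _]]].
  by split; apply/hom_inP; split => // u v uv; rewrite !ffunE; apply: h.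
split=> // u v uv; case: (boolP (u \in A)) => [uA|uB].
  have vA := uA; rewrite (adjA _ _ uv) in vA.
  have := h1 (enum_rank_in uA u) (enum_rank_in vA v).
  by rewrite !ffunE /= !enum_rankK_in //; apply.
have vB := uB; rewrite (adjA _ _ uv) in vB.
have uB' : u \in predC A by []. have vB' : v \in predC A by [].
have := h2 (enum_rank_in uB' u) (enum_rank_in vB' v).
by rewrite !ffunE /= !enum_rankK_in //; apply.
Qed.

Lemma connected_hom_in F H (f : {ffun 'I_(nverts F) -> vertex H})
    (A B : pred (vertex H)) :
  connected_graph F -> (forall x y, B x -> B y -> edge x y -> A x = A y) ->
  hom_in (@edge H) B f -> forall u v, A (f u) = A (f v).
Proof.
move=> cF AB /hom_inP [h1 h2] u v.
have cl : fingraph.closed (@adj F) [pred z | A (f z)].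
  by move=> a b ab; rewrite !inE; apply: AB => //; exact: h1.
by have := closed_connect cl (cF u v); rewrite !inE.
Qed.

(** A connected F maps to one side of a cut that no edge crosses. *)
Lemma dens_cut F H (A B : pred (vertex H)) :
  connected_graph F -> (forall x y, B x -> B y -> edge x y -> A x = A y) ->
  dens F B = dens F (predI B A) + dens F (predI B (predC A)).
Proof.
move=> cF AB; rewrite /dens -expectD; apply: eq_expect => f.
have [hB|hB] := boolP (hom_in (edge (w:=H)) B f); last first.
  have -> : hom_in (edge (w:=H)) (predI B A) f = false.
    apply: contraNF hB => /hom_inP [h1 h2]; apply/hom_inP; split => // x.
    by case/andP: (h2 x).
  have -> : hom_in (edge (w:=H)) (predI B (predC A)) f = false.
    apply: contraNF hB => /hom_inP [h1 h2]; apply/hom_inP; split => // x.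
    by case/andP: (h2 x).
  by rewrite addr0.
have Af := connected_hom_in cF AB hB.
pose o := Ordinal (nverts_gt0 F).
have [h1 h2] := hom_inP _ _ _ hB.
have -> : hom_in (edge (w:=H)) (predI B A) f = A (f o).
  apply/hom_inP/idP => [[_ /(_ o)/andP[]]//|Ao]; split => // x.
  by rewrite /= h2 (Af x o).
have -> : hom_in (edge (w:=H)) (predI B (predC A)) f = ~~ A (f o).
  apply/hom_inP/idP => [[_ /(_ o)/andP[]]//|Ao]; split => // x.
  by rewrite /= h2 (Af x o).
by case: (A (f o)); rewrite ?addr0 ?add0r.
Qed.

Lemma mass_cut H (A B : pred (vertex H)) :
  mass B = mass (predI B A) + mass (predI B (predC A)).
Proof. exact: bigID. Qed.

Lemma mass_predT H : mass (H := H) predT = 1.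
Proof. exact: weight_sum. Qed.
End WeightedGraph.
Arguments wgraph : clear implicits.

(** * Sampling from weighted graphs *)

Section Sampling.
Context {R : realType}.

Definition sample_graph (H : wgraph R) k (k0 : (0 < k)%N)
    (s : {ffun 'I_k -> vertex H}) : graph :=
  @Graph k (fun a b => edge (s a) (s b)) (fun a b => edge_sym _ _)
    (fun a => edge_irrefl _) k0.

Definition sample_dens (H : wgraph R) (P : pred (vertex H)) (F : graph) k
    (k0 : (0 < k)%N) (s : {ffun 'I_k -> vertex H}) : R :=
  dens F (H := uniform (sample_graph k0 s)) (fun a => P (s a)).

Lemma sample_densE F H P k k0 s :
  @sample_dens H P F k k0 s =
  expect (@unif_weight R k) (fun p : {ffun 'I_(nverts F) -> 'I_k} =>
    (hom_in (@edge R H) P (pullback p s))%:R).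
Proof.
apply: eq_expect => p; congr (nat_of_bool _)%:R.
apply/hom_inP/hom_inP => -[h1 h2]; split=> x; rewrite ?ffunE; try exact: h2.
- by move=> y xy; rewrite !ffunE; exact: h1.
- by move=> y xy; have := h1 _ _ xy; rewrite !ffunE.
- by have := h2 x; rewrite ffunE.
Qed.

(** Chebyshev's inequality. *)
Lemma sample_dens_concentrated F H P k k0 (e : R) : 0 < e ->
  expect (@weight R H) (fun s : {ffun 'I_k -> _} =>
    (e <= `|@sample_dens H P F k k0 s - dens F P|)%R%:R) <=
  6 * (nverts F ^ 2)%:R / k%:R / e ^+ 2.
Proof.
move=> e0; rewrite ler_pdivlMr ?exprn_gt0 // mulrC.
have := @expect_sample_variance R _ _ k _ (fun f : {ffun 'I_(nverts F) -> _} =>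
  (hom_in (@edge R H) P f)%:R) k0 (@weight_ge0 R H) (weight_sum H).
rewrite card_ord => var; apply: le_trans (var _); last first.
  by move=> f; rewrite ler0n lern1 leq_b1.
apply: expect_markov => [x|s|s]; [exact: weight_ge0|exact: sqr_ge0|].
rewrite sample_densE => le_e; rewrite -[X in _ <= X]real_normK ?num_real //.
by rewrite lerXn2r ?nnegrE ?normr_ge0 // ltW.
Qed.

(** The adjacency matrix of the sample, in a type that depends only on its size,
so that samples of different populations can be compared. *)
Definition pattern (H : wgraph R) k (s : {ffun 'I_k -> vertex H}) :
    {ffun 'I_k * 'I_k -> bool} :=
  [ffun ab => edge (s ab.1) (s ab.2)].

Definition pattern_prob (H : wgraph R) k (q : {ffun 'I_k * 'I_k -> bool}) : R :=
  expect (@weight R H) (fun s => (pattern s == q)%:R).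

(** Containing the edges of q splits into the exact patterns above q. *)
Lemma pattern_prob_up (H : wgraph R) k (q : {ffun 'I_k * 'I_k -> bool}) :
  expect (@weight R H) (fun s => [forall ab, q ab ==> pattern s ab]%:R) =
  \sum_(q' : {ffun 'I_k * 'I_k -> bool} | [forall ab, q ab ==> q' ab])
    pattern_prob H q'.
Proof.
rewrite /pattern_prob -expect_sum; apply: eq_expect => s.
case: (boolP [forall ab, _]) => qs.
  rewrite (bigD1 (pattern s)) //= eqxx big1 ?addr0 // => q' /andP[_ /negPf].
  by rewrite eq_sym => ->.
rewrite big1 // => q' qq'; case: eqP => // sq'; move: qs.
by rewrite sq' qq'.
Qed.

(** The probability that the sample contains a given graph is a homomorphism
density, and these probabilities determine the exact distribution of the sample
by downward induction on the set of edges. *)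
Lemma pattern_prob_cvg (H H' : nat -> wgraph R) k :
  (forall F : graph, dens F (H := H n) predT - dens F (H := H' n) predT
     @[n --> \oo] --> (0 : R)) ->
  (0 < k)%N -> forall q : {ffun 'I_k * 'I_k -> bool},
  pattern_prob (H n) q - pattern_prob (H' n) q @[n --> \oo] --> (0 : R).
Proof.
move=> HH' k0 q; have [m] := ubnP #|[pred ab | ~~ q ab]|.
elim: m q => // m IH q; rewrite ltnS => qm.
have [/andP[q_sym q_irr]|nq] := boolP ([forall a, forall b, q (a, b) == q (b, a)]
    && [forall a, ~~ q (a, a)]); last first.
  have p0 (K : wgraph R) : pattern_prob K q = 0.
    rewrite /pattern_prob /expect big1 // => s _.
    case: eqP => [sq|_]; last by rewrite mulr0.
    case/negP: nq; apply/andP; rewrite -sq; split.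
      apply/forallP => a; apply/forallP => b; rewrite !ffunE /=.
      by rewrite edge_sym.
    by apply/forallP => a; rewrite ffunE /= edge_irrefl.
  under eq_fun do rewrite !p0 subrr; exact: cvg_cst.
have Fsym : symmetric (fun a b => q (a, b)).
  by move=> a b; apply/eqP; move/forallP/(_ a)/forallP/(_ b) : q_sym.
have Firr : irreflexive (fun a => [eta (fun b => q (a, b))]).
  by move=> a; apply/negbTE; move/forallP/(_ a) : q_irr.
pose F := Graph Fsym Firr k0.
have densF (K : wgraph R) : dens F (H := K) predT = \sum_(q' : {ffun 'I_k * 'I_k -> bool} |
    [forall ab, q ab ==> q' ab]) pattern_prob K q'.
  rewrite -pattern_prob_up; apply: eq_expect => s; congr (nat_of_bool _)%:R.
  apply/hom_inP/forallP => /= [[h1 _] [a b]|h].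
    by apply/implyP => qab; rewrite ffunE; exact: h1.
  split=> // a b qab; have := h (a, b); rewrite ffunE /= => /implyP; exact.
have self : [forall ab, q ab ==> q ab] by apply/forallP => ab; apply/implyP.
have E n : pattern_prob (H n) q - pattern_prob (H' n) q =
   (dens F (H := H n) predT - dens F (H := H' n) predT) -
   \sum_(q' : {ffun 'I_k * 'I_k -> bool} | [forall ab, q ab ==> q' ab] && (q' != q))
    (pattern_prob (H n) q' - pattern_prob (H' n) q').
  rewrite !densF (bigD1 q) //= [X in _ - X - _](bigD1 q) //= sumrB; ring.
under eq_fun do rewrite E.
have Z : 0 = 0 - \sum_(q' : {ffun 'I_k * 'I_k -> bool} |
    [forall ab, q ab ==> q' ab] && (q' != q)) 0 :> R by rewrite big1 // subr0.
suff : dens F (H := H n) predT - dens F (H := H' n) predT -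
    \sum_(q' : {ffun 'I_k * 'I_k -> bool} | [forall ab, q ab ==> q' ab] && (q' != q))
    (pattern_prob (H n) q' - pattern_prob (H' n) q') @[n --> \oo] -->
    (0 - \sum_(q' : {ffun 'I_k * 'I_k -> bool} |
    [forall ab, q ab ==> q' ab] && (q' != q)) 0 : R) by rewrite -Z.
apply: cvgB; first exact: HH'.
apply: cvg_big => [|q' /andP[/forallP qq' q'q]]; first exact: add_continuous.
apply: IH; apply: leq_trans qm; apply: proper_card; apply/properP; split.
  apply/fintype.subsetP => ab; rewrite !inE; apply: contra => qab.
  exact: (implyP (qq' ab)).
have [ab qab] : exists ab, q ab != q' ab.
  apply/existsP; apply: contraNT q'q; rewrite negb_exists => /forallP e.
  by apply/eqP/ffunP => ab; have := e ab; rewrite negbK => /eqP.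
exists ab; rewrite !inE; have := qq' ab; move: qab.
  by case: (q ab); case: (q' ab).
by case: (q ab); case: (q' ab).
Qed.

(** The label None selects all vertices, so that densities in the whole graph and
in its label classes are treated at once; vertices labelled None belong to no
class. *)
Definition sel (V : Type) (I : eqType) (lab : V -> option I) (o : option I) :
  pred V := fun x => (o == None) || (lab x == o).

Definition respects (V : Type) (L : eqType) (e : rel V) (lab : V -> L) :=
  forall a b, e a b -> lab a = lab b.

Definition labelled_limit (I : eqType) (H : nat -> wgraph R)
    (lab : forall n, vertex (H n) -> option I) (x : graph -> option I -> R) :=
  (forall n, respects (@edge R (H n)) (lab n)) /\
  forall F o, dens F (sel (lab n) o) @[n --> \oo] --> x F o.

Lemma expect_has_le (T : finType) (w : T -> R) (k m : nat)
    (B : 'I_m -> pred {ffun 'I_k -> T}) (c : 'I_m -> R) :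
  (forall x, 0 <= w x) ->
  (forall i, expect w (fun s => (B i s)%:R) <= c i) ->
  expect w (fun s => [exists i, B i s]%:R) <= \sum_i c i.
Proof.
move=> w0 Bc; apply: (@le_trans _ _ (\sum_i expect w (fun s => (B i s)%:R))).
  rewrite -expect_sum; apply: ler_expect => // s.
  case: existsP => [[i Bi]|_]; last by apply: sumr_ge0.
  by rewrite (bigD1 i) //= Bi lerDl sumr_ge0.
exact: ler_sum.
Qed.

Lemma pattern_prob_set (H : wgraph R) k
    (Q : pred {ffun 'I_k * 'I_k -> bool}) :
  expect (@weight R H) (fun s => (Q (pattern s))%:R) =
  \sum_(q | Q q) pattern_prob H q.
Proof.
rewrite /pattern_prob -expect_sum; apply: eq_expect => s.
case: (boolP (Q _)) => qs.
  rewrite (bigD1 (pattern s)) //= eqxx big1 ?addr0 // => q' /andP[_ /negPf].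
  by rewrite eq_sym => ->.
rewrite big1 // => q' qq'; case: eqP => // sq'; move: qs.
by rewrite sq' qq'.
Qed.

Lemma pattern_prob_sum (H : wgraph R) k :
  \sum_(q : {ffun 'I_k * 'I_k -> bool}) pattern_prob H q = 1.
Proof.
apply: etrans (esym (@pattern_prob_set H k xpredT)) _.
exact: expect_cst (weight_sum H).
Qed.

Definition typical (H : wgraph R) k (k0 : (0 < k)%N) m (F : 'I_m -> graph)
    (P : 'I_m -> pred (vertex H)) (e : R) (s : {ffun 'I_k -> vertex H}) : bool :=
  [forall i, `|sample_dens (P i) (F i) k0 s - dens (F i) (P i)| < e].

(** The bound on the sum makes k so large that, by a union bound, atypical samples
have probability at most 1 / 4. *)
Lemma typical_patterns (H : wgraph R) k (k0 : (0 < k)%N) m (F : 'I_m -> graph)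
    (P : 'I_m -> pred (vertex H)) (e : R) : 0 < e ->
  \sum_i 6 * (nverts (F i) ^ 2)%:R / e ^+ 2 <= k%:R / 4 ->
  3 / 4 <= \sum_(q | [exists s, (pattern s == q) && typical k0 F P e s])
             pattern_prob H q.
Proof.
move=> e0 Ck; rewrite -pattern_prob_set.
have k0' : 0 < k%:R :> R by rewrite ltr0n.
pose bad (s : {ffun 'I_k -> vertex H}) := [exists i,
  e <= `|sample_dens (P i) (F i) k0 s - dens (F i) (P i)|].
have badP : expect (@weight R H) (fun s => (bad s)%:R) <= 1 / 4.
  apply: (@le_trans _ _
      ((\sum_i 6 * (nverts (F i) ^ 2)%:R / e ^+ 2) / k%:R)); last first.
    by rewrite ler_pdivrMr // mul1r mulrC.
  rewrite mulr_suml; apply: expect_has_le => [y|i].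
    exact: weight_ge0.
  by rewrite mulrAC; apply: sample_dens_concentrated.
pose Q q := [exists s : {ffun 'I_k -> vertex H},
  (pattern s == q) && typical k0 F P e s].
have : 1 <= expect (@weight R H)
    (fun s : {ffun 'I_k -> _} => (Q (pattern s))%:R + (bad s)%:R).
  rewrite -[leLHS](expect_cst 'I_k 1 (weight_sum H)).
  apply: ler_expect => [y|s]; first exact: weight_ge0.
  rewrite -natrD ler1n; have [_|bs] := boolP (bad s); first by rewrite addn_gt0 orbT.
  suff -> : Q (pattern s) by [].
  apply/existsP; exists s; rewrite eqxx; apply/forallP => i.
  by move: bs; rewrite negb_exists => /forallP/(_ i); rewrite -ltNge.
rewrite expectD -/(Q _); set a := expect _ _; set b := expect _ _ in badP *.
by move: a b badP => a b; lra.
Qed.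

(** The two laws differ by at most 1 / 4 in total, so Q' has probability at least
1 / 2 for H; were Q and Q' disjoint, they would have a total of at least 5 / 4. *)
Lemma common_pattern (H H' : wgraph R) k
    (Q Q' : pred {ffun 'I_k * 'I_k -> bool}) :
  3 / 4 <= \sum_(q | Q q) pattern_prob H q ->
  3 / 4 <= \sum_(q | Q' q) pattern_prob H' q ->
  (forall q : {ffun 'I_k * 'I_k -> bool}, `|pattern_prob H q - pattern_prob H' q| <=
     (4 * #|{ffun 'I_k * 'I_k -> bool}|%:R)^-1) ->
  exists q, Q q && Q' q.
Proof.
move=> QP Q'P hp; set p := @pattern_prob H k in QP hp *.
have diff : \sum_(q | Q' q) (pattern_prob H' q - p q) <= 1 / 4.
  apply: (@le_trans _ _ (\sum_(q : {ffun 'I_k * 'I_k -> bool})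
      (4 * #|{ffun 'I_k * 'I_k -> bool}|%:R)^-1)).
    rewrite [leRHS](bigID Q') /= -[leLHS]addr0 lerD //; last first.
      by apply: sumr_ge0 => q _; rewrite invr_ge0 mulr_ge0 ?ler0n.
    apply: ler_sum => q _; apply: le_trans (hp q).
    by rewrite distrC ler_norm.
  rewrite sumr_const -[leLHS]mulr_natl invfM mulrCA divff ?mulr1 ?mul1r //.
  rewrite pnatr_eq0 -lt0n; apply/card_gt0P.
  by exists [ffun _ => false].
rewrite sumrB in diff.
apply/existsP; apply: contraT; rewrite negb_exists => /forallP QQ'.
have : \sum_(q | Q q) p q + \sum_(q | Q' q) p q <= 1.
  rewrite -(@pattern_prob_sum H k) [leRHS](bigID Q) /= lerD2l.
  rewrite [leRHS]big_mkcond [leLHS]big_mkcond /=.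
  apply: ler_sum => q _; have := QQ' q.
  have : 0 <= pattern_prob H q.
    by apply: expect_ge0 => // y; exact: weight_ge0.
  by rewrite /p; case: (Q q); case: (Q' q).
set a := \sum_(q | Q q) _ in QP *; set b := \sum_(q | Q' q) p q in diff *.
set c := \sum_(q | Q' q) _ in Q'P diff *.
by move: a b c QP Q'P diff => a b c; lra.
Qed.

(** Two populations with the same limit have samples with almost the same
distribution, so that one and the same graph is a typical sample of both. It
then carries the labels of both populations. *)
Lemma overlay_finite (I J : eqType) (H H' : nat -> wgraph R)
    (lab : forall n, vertex (H n) -> option I)
    (lab' : forall n, vertex (H' n) -> option J) x x' :
  labelled_limit lab x -> labelled_limit lab' x' ->
  (forall F, x F None = x' F None) ->
  forall (m N : nat) (e : R) (c : nat -> graph * option I)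
    (c' : nat -> graph * option J), 0 < e ->
  exists (S : graph) (l : 'I_(nverts S) -> option I)
    (l' : 'I_(nverts S) -> option J),
    [/\ (N <= nverts S)%N, respects (@adj S) l, respects (@adj S) l' &
      forall i, (i < m)%N ->
        `|dens (c i).1 (H := uniform S) (sel l (c i).2) - x (c i).1 (c i).2| < e
      /\ `|dens (c' i).1 (H := uniform S) (sel l' (c' i).2)
           - x' (c' i).1 (c' i).2| < e].
Proof.
move=> [resp Hx] [resp' Hx'] xx' m N e c c' e0.
have e20 : 0 < e / 2 by rewrite divr_gt0.
pose C := \sum_(i < m) 6 * (nverts (c i).1 ^ 2)%:R / (e / 2) ^+ 2.
pose C' := \sum_(i < m) 6 * (nverts (c' i).1 ^ 2)%:R / (e / 2) ^+ 2.
pose k := maxn N.+1 (maxn (Num.truncn (4 * C)).+1 (Num.truncn (4 * C')).+1).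
have k0 : (0 < k)%N by rewrite leq_max.
have kN : (N <= k)%N by rewrite leq_max leqnSn.
have Ck : C <= k%:R / 4.
  rewrite ler_pdivlMr // mulrC; apply: le_trans (ltW (truncnS_gt _)) _.
  by rewrite ler_nat !leq_max leqnn orbT.
have C'k : C' <= k%:R / 4.
  rewrite ler_pdivlMr // mulrC; apply: le_trans (ltW (truncnS_gt _)) _.
  by rewrite ler_nat !leq_max leqnn !orbT.
clearbody k.
have probs : \forall n \near \oo, forall q : {ffun 'I_k * 'I_k -> bool},
   `|pattern_prob (H n) q - pattern_prob (H' n) q| <
     (4 * #|{ffun 'I_k * 'I_k -> bool}|%:R)^-1.
  have HH' F : dens F (H := H n) predT - dens F (H := H' n) predT
     @[n --> \oo] --> (0 : R).
    rewrite -(subrr (x F None)); apply: cvgB; first exact: Hx.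
    rewrite xx'; exact: Hx'.
  pose P (q : {ffun 'I_k * 'I_k -> bool}) n :=
    `|pattern_prob (H n) q - pattern_prob (H' n) q| <
     (4 * #|{ffun 'I_k * 'I_k -> bool}|%:R)^-1.
  have PQ (q : {ffun 'I_k * 'I_k -> bool}) : \forall n \near \oo, P q n.
    have := pattern_prob_cvg HH' k0 q => /cvgr0_norm_lt; apply.
    rewrite invr_gt0 mulr_gt0 ?ltr0n //; apply/card_gt0P.
    by exists [ffun _ => false].
  exact: filter_forall.
have near_x : \forall n \near \oo, forall i : 'I_m,
  `|x (c i).1 (c i).2 - dens (c i).1 (sel (lab n) (c i).2)| < e / 2.
  apply: filter_forall => i.
  by have /cvgrPdist_lt := Hx (c i).1 (c i).2; apply.
have near_x' : \forall n \near \oo, forall i : 'I_m,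
  `|x' (c' i).1 (c' i).2 - dens (c' i).1 (sel (lab' n) (c' i).2)| < e / 2.
  apply: filter_forall => i.
  by have /cvgrPdist_lt := Hx' (c' i).1 (c' i).2; apply.
have [n [hp [hx hx']]] := filter_ex (filterI probs (filterI near_x near_x')).
have T := @typical_patterns (H n) k k0 m (fun i => (c i).1)
  (fun i => sel (lab n) (c i).2) _ e20 Ck.
have T' := @typical_patterns (H' n) k k0 m (fun i => (c' i).1)
  (fun i => sel (lab' n) (c' i).2) _ e20 C'k.
have [q] := common_pattern T T' (fun q => ltW (hp q)).
move=> {T T'} /andP[/existsP[s /andP[/eqP sq /forallP gs]]].
move=> /existsP[s' /andP[/eqP sq' /forallP gs']].
have adjE a b : edge (s a) (s b) = edge (s' a) (s' b).
  by move: sq'; rewrite -sq => /ffunP/(_ (a, b)); rewrite !ffunE.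
exists (sample_graph k0 s), (fun a => lab n (s a)), (fun a => lab' n (s' a)).
split=> //.
- by move=> a b; exact: resp.
- by move=> a b /=; rewrite adjE; exact: resp'.
move=> i im; have h1 := hx (Ordinal im); have h2 := hx' (Ordinal im).
move: {gs gs'} (gs (Ordinal im)) (gs' (Ordinal im)) h1 h2 => /= gs gs' h1 h2.
have E : dens (R := R) (c' i).1 (H := uniform (sample_graph k0 s))
     (sel (fun a => lab' n (s' a)) (c' i).2) =
     dens (R := R) (c' i).1 (H := uniform (sample_graph k0 s'))
     (sel (fun a => lab' n (s' a)) (c' i).2).
  apply: eq_expect => p; congr (nat_of_bool _)%:R.
  by apply/hom_inP/hom_inP => -[g1 g2]; split => // a b ab; move: (g1 a b ab);
     rewrite /= adjE.
rewrite E {E}; rewrite distrC in h1; rewrite distrC in h2; split.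
  rewrite (splitr e); apply: le_lt_trans (ltrD gs h1).
  exact: ler_distD.
rewrite (splitr e); apply: le_lt_trans (ltrD gs' h2).
exact: ler_distD.
Qed.
End Sampling.

(** * Graph limits *)

Section Enumeration.

Lemma graph_eq n (a b : 'I_n -> 'I_n -> bool) sa sb ia ib na nb :
  (forall x y, a x y = b x y) ->
  @Graph n a sa ia na = @Graph n b sb ib nb.
Proof.
move=> ab; have {ab} E : a = b by apply/funext => x; apply/funext => y.
by case: b / E sb ib => sb ib; congr Graph; exact: Prop_irrelevance.
Qed.

(** Graphs are encoded by matrices of booleans that are symmetrised when decoded:
every matrix is a code, and there are countably many of them. *)
Definition graph_code := {n : nat & {ffun 'I_n.+1 * 'I_n.+1 -> bool}}.

Definition decode_adj (c : graph_code) (x y : 'I_(tag c).+1) : bool :=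
  (x != y) && (tagged c (x, y) || tagged c (y, x)).

Lemma decode_sym c : symmetric (@decode_adj c).
Proof. by move=> x y; rewrite /decode_adj eq_sym orbC. Qed.

Lemma decode_irrefl c : irreflexive (@decode_adj c).
Proof. by move=> x; rewrite /decode_adj eqxx. Qed.

Definition decode_graph (c : graph_code) : graph :=
  Graph (@decode_sym c) (@decode_irrefl c) (ltn0Sn _).

Lemma decode_graph_surj F : exists c, decode_graph c = F.
Proof.
case: F => -[//|n] a s i n0.
exists (Tagged (fun n => {ffun 'I_n.+1 * 'I_n.+1 -> bool})
  [ffun p => a p.1 p.2]).
apply: graph_eq => x y; rewrite /decode_adj !ffunE /= (s y x) orbb.
by case: eqP => // ->; rewrite i.
Qed.

Definition enum_graph (n : nat) : graph :=
  decode_graph (odflt (Tagged (fun n => {ffun 'I_n.+1 * 'I_n.+1 -> bool})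
    (i := 0%N) [ffun=> false]) (unpickle n)).

Lemma enum_graph_surj F : exists n, enum_graph n = F.
Proof.
have [c <-] := decode_graph_surj F; exists (pickle c).
by rewrite /enum_graph pickleK.
Qed.

Definition enum_graph_label (I : countType) (n : nat) : graph * option I :=
  let p := odflt (0%N, None) (unpickle n) in (enum_graph p.1, p.2).

Lemma enum_graph_label_surj (I : countType) F (o : option I) :
  exists n, enum_graph_label I n = (F, o).
Proof.
have [m <-] := enum_graph_surj F; exists (pickle (m, o)).
by rewrite /enum_graph_label pickleK.
Qed.
End Enumeration.

Section Limits.
Context {R : realType}.

(** As there are countably many graphs, approximating finitely many densities at a
time is enough: a diagonal sequence then approximates all of them. *)
Lemma approx_graph_limit (t : graph -> R) :
  (forall (m N : nat) (e : R), 0 < e -> exists G, (N <= nverts G)%N /\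
    forall i, (i < m)%N ->
      `|hom_density R (enum_graph i) G - t (enum_graph i)| < e) ->
  is_graph_limit t.
Proof.
move=> appr.
have /choice[G HG] (n : nat) : exists G, (n <= nverts G)%N /\
    forall i, (i < n)%N ->
      `|hom_density R (enum_graph i) G - t (enum_graph i)| < n.+1%:R^-1.
  by apply: appr; rewrite invr_gt0.
exists G; split => [|F].
  apply/cvgnyPge => N; near=> n; apply: leq_trans (HG n).1.
  by near: n; exact: nbhs_infty_ge.
have [i <-] := enum_graph_surj F.
apply/cvgrPdistC_lt => e e0; near=> n.
apply: lt_trans ((HG n).2 i _) _; first by near: n; exact: nbhs_infty_gt.
by near: n; exact: near_infty_natSinv_lt (PosNum e0).
Unshelve. all: by end_near. Qed.

Lemma graph_limit_approx (Gamma : graph_limit R) (m N : nat) (e : R) : 0 < e ->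
  exists G, (N <= nverts G)%N /\ forall i, (i < m)%N ->
      `|hom_density R (enum_graph i) G - Gamma (enum_graph i)| < e.
Proof.
move=> e0; have [G [vG tG]] := density_limit Gamma.
have near_t : \forall n \near \oo, forall i : 'I_m,
    `|hom_density R (enum_graph i) (G n) - Gamma (enum_graph i)| < e.
  by apply: filter_forall => i; have /cvgrPdistC_lt := tG (enum_graph i); apply.
have near_v : \forall n \near \oo, (N <= nverts (G n))%N.
  by move/cvgnyPge : vG; apply.
have [n [nt nv]] := filter_ex (filterI near_t near_v).
by exists (G n); split => // i im; exact: nt (Ordinal im).
Qed.

(** The space of graph limits is closed. *)
Lemma cvg_graph_limit (U : set_system nat) {PU : ProperFilter U}
    (G : nat -> graph_limit R) (t : graph -> R) :
  (forall F, G n F @[n --> U] --> t F) -> is_graph_limit t.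
Proof.
move=> Gt; apply: approx_graph_limit => m N e e0.
have e20 : 0 < e / 2 by rewrite divr_gt0.
have near_t : \forall n \near U, forall i : 'I_m,
    `|G n (enum_graph i) - t (enum_graph i)| < e / 2.
  by apply: filter_forall => i; have /cvgrPdistC_lt := Gt (enum_graph i); apply.
have [n nt] := filter_ex near_t.
have [G' [vG' G't]] := graph_limit_approx (G n) m N e20.
exists G'; split => // i im; rewrite (splitr e).
apply: le_lt_trans (ltrD (G't i im) (nt (Ordinal im))).
exact: ler_distD.
Qed.

Lemma cvg_graphs_limit (U : set_system nat) {PU : ProperFilter U}
    (G : nat -> graph) (t : graph -> R) :
  (forall N, \forall n \near U, (N <= nverts (G n))%N) ->
  (forall F, hom_density R F (G n) @[n --> U] --> t F) -> is_graph_limit t.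
Proof.
move=> vG Gt; apply: approx_graph_limit => m N e e0.
have near_t : \forall n \near U, forall i : 'I_m,
    `|hom_density R (enum_graph i) (G n) - t (enum_graph i)| < e.
  by apply: filter_forall => i; have /cvgrPdistC_lt := Gt (enum_graph i); apply.
have [n [nt nv]] := filter_ex (filterI near_t (vG N)).
by exists (G n); split => // i im; exact: nt (Ordinal im).
Qed.

Lemma graph_limit_eq (Gamma Delta : graph_limit R) :
  (forall F, Gamma F = Delta F) -> Gamma = Delta.
Proof.
case: Gamma Delta => [t ht] [u hu] /= /funext E.
by case: u / E hu => hu; congr GraphLimit; exact: Prop_irrelevance.
Qed.

Lemma graph_limit01 (Gamma : graph_limit R) F : 0 <= Gamma F <= 1.
Proof.
have [G [_ /(_ F) tG]] := density_limit Gamma.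
apply/andP; split.
  apply: (cvgr_to_ge tG); apply: nearW => n.
  by rewrite hom_densityE dens_ge0.
apply: (cvgr_to_le tG); apply: nearW => n.
by rewrite hom_densityE dens_le1.
Qed.

(** Densities of arbitrary graphs reduce to those of connected graphs with an
edge, as every graph is a disjoint union of connected ones. *)
Lemma graph_components_ind (P : graph -> Prop) :
  (forall F, ~ has_edge F -> P F) ->
  (forall F, connected_graph F -> has_edge F -> P F) ->
  (forall F F1 F2, (forall H : wgraph R, dens F (H := H) predT =
      dens F1 (H := H) predT * dens F2 (H := H) predT) -> P F1 -> P F2 -> P F) ->
  forall F, P F.
Proof.
move=> P0 P1 P2 F; have [n] := ubnP (nverts F).
elim: n F => // n IH F; rewrite ltnS => Fn.
have [eF|neF] := pselect (has_edge F); last exact: P0.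
have [cF|ncF] := pselect (connected_graph F); first exact: P1.
have [F1 [F2 [lt1 lt2 E]]] := dens_disconnected (R := R) ncF.
by apply: P2 E _ _; apply: IH; [exact: leq_trans Fn|exact: leq_trans Fn].
Qed.

Lemma graph_limit_noedge (Gamma : graph_limit R) F :
  ~ has_edge F -> Gamma F = 1.
Proof.
move=> F0; have [G [_ /(_ F) tG]] := density_limit Gamma.
apply: (cvg_unique _ tG) => //=.
by under eq_fun do rewrite hom_densityE dens_noedge //; exact: cvg_cst.
Qed.

Lemma graph_limitM (Gamma : graph_limit R) F F1 F2 :
  (forall H : wgraph R, dens F (H := H) predT =
      dens F1 (H := H) predT * dens F2 (H := H) predT) ->
  Gamma F = Gamma F1 * Gamma F2.
Proof.
move=> E; have [G [_ tG]] := density_limit Gamma.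
apply: (cvg_unique _ (tG F)) => //=.
under eq_fun do rewrite hom_densityE E -!hom_densityE.
by apply: cvgM; exact: tG.
Qed.

Lemma graph_limit_determined (Gamma Delta : graph_limit R) :
  (forall F, connected_graph F -> has_edge F -> Gamma F = Delta F) ->
  Gamma = Delta.
Proof.
move=> GD; apply: graph_limit_eq; apply: graph_components_ind => //.
  by move=> F F0; rewrite !graph_limit_noedge.
by move=> F F1 F2 E E1 E2; rewrite !(graph_limitM _ E) E1 E2.
Qed.

Lemma dens_cvg_connected (U : set_system nat) {PU : ProperFilter U}
    (H : nat -> wgraph R) (Gamma : graph_limit R) :
  (forall F, connected_graph F -> has_edge F ->
     dens F (H := H n) predT @[n --> U] --> Gamma F) ->
  forall F, dens F (H := H n) predT @[n --> U] --> Gamma F.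
Proof.
move=> GD; apply: graph_components_ind => //.
  move=> F F0; rewrite graph_limit_noedge //.
  by under eq_fun do rewrite dens_noedge //; exact: cvg_cst.
move=> F F1 F2 E E1 E2; rewrite (graph_limitM _ E).
by under eq_fun do rewrite E; exact: cvgM.
Qed.

(** Limits along an ultrafilter replace the extraction of subsequences: all the
bounded sequences at hand converge simultaneously. *)
Lemma bounded_ultra_cvg (U : set_system nat) (UU : UltraFilter U)
    (u : nat -> R) : (forall n, 0 <= u n <= 1) -> cvg (u n @[n --> U]).
Proof.
move=> u01; have [p [_ clp]] : exists p, (`[0, 1]%classic `&` cluster (u n @[n --> U])) p.
  apply: segment_compact; apply: (@filterS _ U _ setT) => //; last exact: filterT.
  by move=> n _ /=; rewrite in_itv /= u01.
apply/cvg_ex; exists p => B nB.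
have [//|cB] := in_ultra_setVsetC (u @^-1` B) UU.
by have [z [/= nBz Bz]] := clp (~` B) B cB nB.
Qed.

Lemma free_ultrafilter :
  exists U : set_system nat, UltraFilter U /\ \oo `<=` U.
Proof. exact: ultraFilterLemma. Qed.

Lemma cvg_free (U : set_system nat) (u : nat -> R) (l : R) : \oo `<=` U ->
  u n @[n --> \oo] --> l -> u n @[n --> U] --> l.
Proof. by move=> sub ul A /ul; exact: sub. Qed.
End Limits.

(** * Direct sums as limits of disjoint unions *)

Section Totals.
Context {R : realType}.

Definition bounded_total (I : choiceType) (a : I -> R) (s : R) :=
  forall X : seq I, uniq X -> \sum_(i <- X) a i <= s.

(** The sum of a nonnegative family is the supremum of its finite partial sums;
this is the real-valued form of \esum. *)
Definition has_total (I : choiceType) (a : I -> R) (s : R) :=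
  bounded_total a s /\
  forall e, 0 < e -> exists2 X : seq I, uniq X & s - e < \sum_(i <- X) a i.

Lemma esum_leP (I : choiceType) (a : I -> R) (s : R) :
  (\esum_(i in [set: I]) (a i)%:E <= s%:E)%E <-> bounded_total a s.
Proof.
split=> [le_s X uX|le_s].
  rewrite -lee_fin; apply: le_trans le_s; apply: esum_ge.
  exists [set` X]; first by split => //; exact: finite_seq.
  by rewrite -fsbig_seq // sumEFin.
apply: ge_ereal_sup => /= _ [X [finX _] <-].
by rewrite fsbig_finite //= sumEFin lee_fin; apply: le_s; exact: finmap.fset_uniq.
Qed.

Lemma esum_has_total (I : choiceType) (a : I -> R) (s : R) :
  \esum_(i in [set: I]) (a i)%:E = s%:E <-> has_total a s.
Proof.
split=> [E|[le_s gt_s]].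
  split; first by apply/esum_leP; rewrite E.
  move=> e e0; have : ((s - e)%:E < \esum_(i in [set: I]) (a i)%:E)%E.
    by rewrite E lte_fin ltrBlDr ltrDl.
  move=> /ereal_sup_gt[_ /= [X [finX _] <-]].
  rewrite fsbig_finite //= sumEFin lte_fin => lt_s.
  by exists (finmap.enum_fset (fset_set X)) => //; exact: finmap.fset_uniq.
apply/eqP; rewrite eq_le; apply/andP; split; first exact/esum_leP.
apply/lee_addgt0Pr => e e0; have [X uX lt_s] := gt_s e e0.
rewrite -leeBlDr // -EFinB; apply: esum_ge.
exists [set` X]; first by split => //; exact: finite_seq.
by rewrite -fsbig_seq // sumEFin lee_fin ltW.
Qed.

Lemma has_total_finite (I : finType) (a : I -> R) :
  (forall i, 0 <= a i) -> has_total a (\sum_i a i).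
Proof.
move=> a0; split => [X uX|e e0]; last first.
  by exists (enum I); rewrite ?enum_uniq // big_enum /= ltrBlDr ltrDl.
rewrite big_uniq //= [leRHS](bigID (mem X)) /= -[leLHS]addr0.
by rewrite lerD ?sumr_ge0.
Qed.

Lemma cvgXn (U : set_system nat) {FU : Filter U} (u : nat -> R) (l : R) k :
  u n @[n --> U] --> l -> u n ^+ k @[n --> U] --> l ^+ k.
Proof.
move=> ul; elim: k => [|k IH]; first exact: cvg_cst.
by under eq_fun do rewrite exprS; rewrite exprS; exact: cvgM.
Qed.
End Totals.

Section DisjointUnion.
Context {R : realType} (I : eqType) (X : seq I) (a : I -> R) (G : I -> graph).
Hypotheses (uniqX : uniq X) (a0 : forall i, 0 <= a i).
Hypothesis a1 : \sum_(i <- X) a i <= 1.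

Let nth_X (k : 'I_(size X)) : I := tnth (in_tuple X) k.

(** The vertex None is isolated and carries the mass missing to the parts. The
parts are indexed by positions in X to form a finite type. *)
Definition union_vertex : finType :=
  option {k : 'I_(size X) & 'I_(nverts (G (nth_X k)))}.

Definition union_edge (u v : union_vertex) : bool :=
  match u, v with
  | Some p, Some q => (tag p == tag q) && adj (tagged p) (tagged_as p q)
  | _, _ => false
  end.

Definition union_weight (u : union_vertex) : R :=
  match u with
  | Some p => a (nth_X (tag p)) / (nverts (G (nth_X (tag p))))%:R
  | None => 1 - \sum_(i <- X) a i
  end.

Let same_tag k (x y : 'I_(nverts (G (nth_X k)))) :
  tagged_as (existT (fun k => 'I_(nverts (G (nth_X k)))) k x)
    (existT (fun k => 'I_(nverts (G (nth_X k)))) k y) = y.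
Proof.
exact: (tagged_asE (u := existT (fun k => 'I_(nverts (G (nth_X k)))) k x)).
Qed.

Lemma union_sym : symmetric union_edge.
Proof.
move=> [[k x]|] [[k' y]|] //=; rewrite eq_sym.
case: eqP => //= E; case: k / E x => x.
by rewrite !same_tag adj_sym.
Qed.

Lemma union_irrefl : irreflexive union_edge.
Proof. by move=> [[k x]|] //=; rewrite eqxx same_tag adj_irrefl. Qed.

Lemma union_weight_ge0 u : 0 <= union_weight u.
Proof. by case: u => [[k x]|] /=; rewrite ?divr_ge0 ?ler0n // subr_ge0. Qed.

Lemma big_option_sum (T : finType) (f : option T -> R) :
  \sum_u f u = f None + \sum_x f (Some x).
Proof.
rewrite (bigD1 None) //=; congr (_ + _).
rewrite (reindex_omap Some id) => [|[x|]] //=.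
by apply: eq_bigl => x; rewrite eqxx.
Qed.

Lemma union_weight_sum : \sum_u union_weight u = 1.
Proof.
rewrite big_option_sum /=.
rewrite -(@sig_big_dep _ _ _ _ (fun k : 'I_(size X) => 'I_(nverts (G (nth_X k))) : finType)
  predT (fun _ => predT) (fun k _ => a (nth_X k) / (nverts (G (nth_X k)))%:R)) /=.
rewrite (big_tnth _ _ X) -/nth_X [X in _ + X](eq_bigr (fun k => a (nth_X k))).
  by rewrite subrK.
move=> k _; rewrite sumr_const card_ord -[LHS]mulr_natr divfK //.
by rewrite pnatr_eq0 -lt0n nverts_gt0.
Qed.

Definition union_graph : wgraph R :=
  WGraph union_sym union_irrefl union_weight_ge0 union_weight_sum.

Definition union_label (u : union_vertex) : option I :=
  if u is Some p then Some (nth_X (tag p)) else None.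

Lemma union_respects : respects union_edge union_label.
Proof. by move=> [p|] [q|] //= /andP[/eqP E _]; rewrite E. Qed.

Lemma dens_union_label F i : i \in X ->
  dens F (H := union_graph) (sel union_label (Some i)) =
  a i ^+ nverts F * hom_density R F (G i).
Proof.
move=> iX; have iX' : (index i X < size X)%N by rewrite index_mem.
pose k := Ordinal iX'.
have ki : nth_X k = i by rewrite /nth_X (tnth_nth i) /= nth_index.
rewrite -ki; apply: (@dens_embed R F union_graph (G (nth_X k)) _ _
  (fun x => Some (existT (fun k => 'I_(nverts (G (nth_X k)))) k x))).
- move=> x y [] /(congr1 (tagged_as (existT _ k x))).
  by rewrite !same_tag.
- move=> [[l x]|]; rewrite /sel /=; last by apply/esym/codomP => -[].
  apply/eqP/codomP => [[E]|[y yE]]; last exact: (congr1 union_label yE).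
  suff kl : k = l by case: l / kl x E => x _; exists x.
  apply: val_inj => /=; move: E; rewrite /nth_X !(tnth_nth i) /= nth_index //.
  by move=> <-; rewrite index_uniq.
- by move=> x y /=; rewrite eqxx same_tag.
- by [].
Qed.
End DisjointUnion.

Section Decomposition.
Context {R : realType}.

(** A connected F with an edge maps into a single label class. *)
Lemma dens_label_sum (I : eqType) (H : wgraph R) (lab : vertex H -> option I)
    (X : seq I) F :
  respects (@edge R H) lab -> uniq X ->
  (forall x y, edge x y -> exists2 i, i \in X & lab x = Some i) ->
  connected_graph F -> has_edge F ->
  dens F (H := H) predT = \sum_(i <- X) dens F (sel lab (Some i)).
Proof.
move=> resp uX labX cF [x [y xy]]; rewrite /dens -expect_sum_seq.
apply: eq_expect => f; have [hf|nhf] := boolP (hom_in _ predT f); last first.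
  rewrite big1 // => i _; case: (boolP (hom_in _ (sel _ _) f)) => // hf.
  by case/negP: nhf; move/hom_inP: hf => [h _]; apply/hom_inP.
have [h _] := hom_inP _ _ _ hf.
have [i iX fi] := labX _ _ (h _ _ xy).
have fi' z : lab (f z) = Some i.
  have := @connected_hom_in R F H f (fun u => lab u == Some i) predT cF _ hf x z.
  by rewrite fi eqxx => E; apply/eqP/esym/E => u v _ _ /resp ->.
rewrite (bigD1_seq i) //= big1 ?addr0.
  suff -> : hom_in (edge (w:=H)) (sel lab (Some i)) f by [].
  by apply/hom_inP; split => // z; rewrite /sel fi' eqxx.
move=> j ji; case: (boolP (hom_in _ (sel _ _) f)) => // /hom_inP [_ /(_ x)].
by rewrite /sel fi /= => /eqP[] ij; rewrite ij eqxx in ji.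
Qed.

Lemma ler_sum_subset (I : eqType) (Y X : seq I) (f : I -> R) :
  uniq Y -> uniq X -> {subset Y <= X} -> (forall i, 0 <= f i) ->
  \sum_(i <- Y) f i <= \sum_(i <- X) f i.
Proof.
move=> uY uX YX f0; rewrite [leRHS](bigID (mem Y)) /= -[leLHS]addr0.
rewrite lerD ?sumr_ge0 // -[leRHS]big_filter le_eqVlt; apply/orP; left; apply/eqP.
apply: perm_big; apply: uniq_perm; rewrite ?filter_uniq // => i.
by rewrite mem_filter /=; case: (boolP (i \in Y)) => // /YX ->.
Qed.

(** The direct sum of the Gs i with weights a i, zero weights allowed, with its
infinite sums expressed by finite partial sums. *)
Definition decomposes (I : choiceType) (Gamma : graph_limit R) (a : I -> R)
    (Gs : I -> graph_limit R) :=
  [/\ forall i, 0 <= a i, bounded_total a 1 &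
      forall F, connected_graph F -> has_edge F ->
        has_total (fun i => a i ^+ nverts F * Gs i F) (Gamma F)].

Lemma decomposes_le1 (I : choiceType) Gamma (a : I -> R) Gs i :
  decomposes Gamma a Gs -> a i <= 1.
Proof. by case=> a0 a1 _; have := a1 [:: i] isT; rewrite big_seq1. Qed.

Lemma decomposes_expr_le (I : choiceType) Gamma (a : I -> R) Gs i F :
  decomposes Gamma a Gs -> a i ^+ nverts F <= a i.
Proof.
move=> dec; have := decomposes_le1 i dec; have [a0 _ _] := dec.
move=> a1; rewrite -[leRHS]expr1; apply: ler_wiXn2l => //.
exact: nverts_gt0.
Qed.

(** Limits of the labelled densities in graphs approximating a direct sum. *)
Definition component_density (I : choiceType) (Gamma : graph_limit R)
    (a : I -> R) (Gs : I -> graph_limit R) F (o : option I) : R :=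
  if o is Some i then a i ^+ nverts F * Gs i F else Gamma F.

Lemma dens_sel_None (I : eqType) (H : wgraph R) (lab : vertex H -> option I) F :
  dens F (sel lab None) = dens F (H := H) predT.
Proof. exact: eq_dens. Qed.

(** A direct sum is the limit of disjoint unions of graphs approximating its
parts, with vertex weights matching those of the parts and the missing mass on
an isolated vertex. The approximations of the parts are uniform in i, which
makes the sum over the parts converge. *)
Lemma decomposition_limit (I : countType) (Gamma : graph_limit R) (a : I -> R)
    (Gs : I -> graph_limit R) : decomposes Gamma a Gs ->
  exists (H : nat -> wgraph R) (lab : forall n, vertex (H n) -> option I),
    labelled_limit lab (component_density Gamma a Gs).
Proof.
move=> dec; have [a0 a1 tot] := dec.
pose X n : seq I := undup (pmap unpickle (iota 0 n)).
have uX n : uniq (X n) by exact: undup_uniq.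
have inX i n : (pickle i < n)%N -> i \in X n.
  move=> lt_in; rewrite mem_undup mem_pmap; apply/mapP.
  by exists (pickle i); rewrite ?mem_iota // pickleK.
have /choice[G HG] (n : nat) : exists G : I -> graph, forall i, forall j,
    (j < n)%N -> `|hom_density R (enum_graph j) (G i)
       - Gs i (enum_graph j)| < n.+1%:R^-1.
  have /choice[G HG] (i : I) : exists G, forall j, (j < n)%N ->
     `|hom_density R (enum_graph j) G - Gs i (enum_graph j)| < n.+1%:R^-1.
    have [|G [_ HG]] := @graph_limit_approx R (Gs i) n 0 n.+1%:R^-1.
      by rewrite invr_gt0.
    by exists G.
  by exists G.
have G_cvg i F : hom_density R F (G n i) @[n --> \oo] --> Gs i F.
  have [j <-] := enum_graph_surj F; apply/cvgrPdistC_lt => e e0; near=> n.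
  apply: lt_trans (HG n i j _) _; first by near: n; exact: nbhs_infty_gt.
  by near: n; exact: near_infty_natSinv_lt (PosNum e0).
exists (fun n => union_graph (G n) a0 (a1 _ (uX n))).
exists (fun n => @union_label I (X n) (G n)); split => [n|].
  exact: union_respects.
have part_cvg F i : dens F (H := union_graph (G n) a0 (a1 _ (uX n)))
   (sel (@union_label I (X n) (G n)) (Some i)) @[n --> \oo] -->
   a i ^+ nverts F * Gs i F.
  have lim : a i ^+ nverts F * hom_density R F (G n i) @[n --> \oo] -->
      a i ^+ nverts F * Gs i F by apply: cvgM (G_cvg i F); exact: cvg_cst.
  apply: cvg_trans lim; apply: near_eq_cvg; near=> n.
  rewrite dens_union_label //; apply: inX; near: n; exact: nbhs_infty_gt.
move=> F [i|] /=; first exact: part_cvg.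
under eq_fun do rewrite dens_sel_None.
move: F; apply: dens_cvg_connected => F cF eF.
have E n : dens F (H := union_graph (G n) a0 (a1 _ (uX n))) predT =
   \sum_(i <- X n) a i ^+ nverts F * hom_density R F (G n i).
  transitivity (\sum_(i <- X n) dens F
      (H := union_graph (G n) a0 (a1 _ (uX n))) (sel (@union_label I (X n) (G n)) (Some i))).
    apply: dens_label_sum => //; first exact: union_respects.
    move=> [p|] // [q|] // _; exists (tnth (in_tuple (X n)) (tag p)) => //.
    exact: mem_tnth.
  by apply: eq_big_seq => i iX; rewrite dens_union_label.
under eq_fun do rewrite E.
have [le_tot gt_tot] := tot F cF eF.
have near_sub (Y : seq I) : \forall n \near \oo, {subset Y <= X n}.
  exists (\max_(i <- Y) pickle i).+1 => // n /= le_n i iY; apply: inX.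
  by apply: leq_trans le_n; rewrite ltnS; exact: leq_bigmax_seq.
have sum_cvg : \sum_(i <- X n) a i ^+ nverts F * Gs i F @[n --> \oo] --> Gamma F.
  apply/cvgrPdistC_lt => e e0; have [Y uY ltY] := gt_tot e e0; near=> n.
  rewrite ltr_norml; apply/andP; split; last first.
    by apply: le_lt_trans e0; rewrite subr_le0; exact: le_tot.
  rewrite ltrBrDr addrC; apply: lt_le_trans ltY _.
  apply: ler_sum_subset => // [|i].
    by near: n; exact: near_sub.
  by rewrite mulr_ge0 ?exprn_ge0 //; case/andP: (graph_limit01 (Gs i) F).
have err_cvg : \sum_(i <- X n) a i ^+ nverts F *
    (hom_density R F (G n i) - Gs i F) @[n --> \oo] --> (0 : R).
  have [j Fj] := enum_graph_surj F.
  apply/cvgr0Pnorm_lt => e e0; near=> n.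
  apply: le_lt_trans (_ : n.+1%:R^-1 < e); last first.
    by near: n; exact: near_infty_natSinv_lt (PosNum e0).
  apply: le_trans (ler_norm_sum _ _ _) _.
  apply: (@le_trans _ _ (\sum_(i <- X n) a i * n.+1%:R^-1)); last first.
    by rewrite -mulr_suml ler_piMl ?invr_ge0 // (a1 _ (uX n)).
  apply: ler_sum => i _; rewrite normrM ger0_norm ?exprn_ge0 //.
  apply: ler_pM => //; first by rewrite exprn_ge0.
    exact: decomposes_expr_le dec.
  rewrite -Fj; apply/ltW/HG; near: n; exact: nbhs_infty_gt.
rewrite -[Gamma F]addr0.
under eq_fun => n.
  have -> : \sum_(i <- X n) a i ^+ nverts F * hom_density R F (G n i) =
    \sum_(i <- X n) a i ^+ nverts F * Gs i F +
    \sum_(i <- X n) a i ^+ nverts F * (hom_density R F (G n i) - Gs i F).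
    by rewrite -big_split; apply: eq_bigr => i _ /=; ring.
  over.
exact: cvgD.
Unshelve. all: by end_near. Qed.

(** A diagonal sequence of common typical samples, for longer and longer finite
lists of labelled densities. *)
Lemma overlay (I J : countType) (H H' : nat -> wgraph R)
    (lab : forall n, vertex (H n) -> option I)
    (lab' : forall n, vertex (H' n) -> option J) x x' :
  labelled_limit lab x -> labelled_limit lab' x' ->
  (forall F, x F None = x' F None) ->
  exists (S : nat -> graph) (l : forall n, 'I_(nverts (S n)) -> option I)
    (l' : forall n, 'I_(nverts (S n)) -> option J),
    [/\ forall N, \forall n \near \oo, (N <= nverts (S n))%N,
      labelled_limit (H := fun n => uniform (S n)) l x &
      labelled_limit (H := fun n => uniform (S n)) l' x'].
Proof.
move=> Hx Hx' xx'.
pose T := {S : graph & (('I_(nverts S) -> option I) * ('I_(nverts S) -> option J))%type}.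
have /choice[S HS] (n : nat) : exists S : T,
   [/\ (n <= nverts (tag S))%N, respects (@adj (tag S)) (tagged S).1,
       respects (@adj (tag S)) (tagged S).2 &
      forall i, (i < n)%N ->
        `|dens (enum_graph_label I i).1 (H := uniform (tag S))
            (sel (tagged S).1 (enum_graph_label I i).2)
          - x (enum_graph_label I i).1 (enum_graph_label I i).2| < n.+1%:R^-1
      /\ `|dens (enum_graph_label J i).1 (H := uniform (tag S))
            (sel (tagged S).2 (enum_graph_label J i).2)
           - x' (enum_graph_label J i).1 (enum_graph_label J i).2| < n.+1%:R^-1].
  have [|S [l [l' h]]] := overlay_finite Hx Hx' xx' n n (enum_graph_label I)
    (enum_graph_label J) (e := n.+1%:R^-1); first by rewrite invr_gt0.
  by exists (existT _ S (l, l')).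
exists (fun n => tag (S n)), (fun n => (tagged (S n)).1), (fun n => (tagged (S n)).2).
split.
- move=> N; near=> n; have [le_n _ _ _] := HS n; apply: leq_trans le_n.
  by near: n; exact: nbhs_infty_ge.
- split=> [n|F o]; first by have [] := HS n.
  have [i E] := enum_graph_label_surj F o.
  apply/cvgrPdistC_lt => e e0; near=> n; have [_ _ _ /(_ i)] := HS n.
  rewrite E /= => h; apply: lt_trans (h _).1 _; first by near: n; exact: nbhs_infty_gt.
  by near: n; exact: near_infty_natSinv_lt (PosNum e0).
- split=> [n|F o]; first by have [] := HS n.
  have [i E] := enum_graph_label_surj F o.
  apply/cvgrPdistC_lt => e e0; near=> n; have [_ _ _ /(_ i)] := HS n.
  rewrite E /= => h; apply: lt_trans (h _).2 _; first by near: n; exact: nbhs_infty_gt.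
  by near: n; exact: near_infty_natSinv_lt (PosNum e0).
Unshelve. all: by end_near. Qed.
End Decomposition.

(** * Cuts *)

Section Cuts.
Context {R : realType}.

Lemma is_direct_sum2P (a : R) (G1 G2 G : graph_limit R) : 0 <= a <= 1 ->
  is_direct_sum2 a G1 G2 G <->
  forall F, connected_graph F -> has_edge F ->
    G F = a ^+ nverts F * G1 F + (1 - a) ^+ nverts F * G2 F.
Proof.
move=> /andP[a0 a1].
pose f F (i : 'I_2) := tnth [tuple a; 1 - a] i ^+ nverts F *
  tnth [tuple G1; G2] i F.
have f0 F i : 0 <= f F i.
  rewrite /f mulr_ge0 //; last by case/andP: (graph_limit01 (tnth [tuple G1; G2] i) F).
  rewrite exprn_ge0 //; case: i => -[|[|//]] i2; rewrite (tnth_nth 0) //=.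
  by rewrite subr_ge0.
have E F : \sum_i f F i = a ^+ nverts F * G1 F + (1 - a) ^+ nverts F * G2 F.
  by rewrite big_ord_recl big_ord1 /f !(tnth_nth 0) !(tnth_nth G1).
have tot F := (esum_has_total _ _).2 (has_total_finite (f0 F)).
split=> h F cF eF; have := h F cF eF.
  by move: (tot F); rewrite /f /= => ->; rewrite E => -[].
by move=> ->; rewrite -E -(tot F).
Qed.

Context {U : set_system nat} (UU : UltraFilter U) (S : nat -> graph).
Hypothesis vS : forall N, \forall n \near U, (N <= nverts (S n))%N.

(** As the mass of A n stays away from 0, the subgraphs induced on A n grow; all
their densities converge along the ultrafilter, and the limits form a graph
limit. *)
Lemma restricted_limit (A : forall n, pred 'I_(nverts (S n))) (mu : R) :
  mass (H := uniform (S n)) (A n) @[n --> U] --> mu -> 0 < mu ->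
  exists Delta : graph_limit R, forall F,
    dens F (H := uniform (S n)) (A n) @[n --> U] --> mu ^+ nverts F * Delta F.
Proof.
move=> Amu mu0.
pose G n : graph := match pselect (0 < #|A n|)%N with
  | left A0 => induced A0 | right _ => S n end.
have bG F n : 0 <= hom_density R F (G n) <= 1.
  by rewrite hom_densityE dens_ge0 dens_le1.
pose t F : R := lim (hom_density R F (G n) @[n --> U]).
have Gt F : hom_density R F (G n) @[n --> U] --> t F.
  exact: bounded_ultra_cvg.
have mu20 : 0 < mu / 2 by rewrite divr_gt0.
have near_mass : \forall n \near U, mu / 2 < mass (H := uniform (S n)) (A n).
  by apply: (cvgr_gt _ Amu); lra.
have near_A : \forall n \near U, (0 < #|A n|)%N.
  apply: filterS near_mass => n; rewrite mass_uniform lt0n => lt_m.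
  apply/eqP => A0; move: lt_m; rewrite A0 mul0r; lra.
have vG N : \forall n \near U, (N <= nverts (G n))%N.
  pose K := (Num.truncn (N%:R / (mu / 2))).+1.
  have near_K := vS K; near=> n.
  have A0 : (0 < #|A n|)%N by near: n.
  have : mu / 2 < mass (H := uniform (S n)) (A n) by near: n.
  have : (K <= nverts (S n))%N by near: n.
  rewrite /G; case: pselect => // {}A0 Kn /=.
  have Sn0 : 0 < (nverts (S n))%:R :> R by rewrite ltr0n nverts_gt0.
  rewrite mass_uniform ltr_pdivlMr // => ltA.
  rewrite -(ler_nat R) ltW //; apply: le_lt_trans ltA.
  rewrite -ler_pdivrMl // mulrC; apply: le_trans (ltW (truncnS_gt _)) _.
  by rewrite ler_nat.
have Lt : is_graph_limit t by exact: (cvg_graphs_limit vG Gt).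
exists (GraphLimit Lt) => F /=.
have lim : mass (H := uniform (S n)) (A n) ^+ nverts F * hom_density R F (G n)
    @[n --> U] --> mu ^+ nverts F * t F by apply: cvgM (Gt F); exact: cvgXn.
apply: cvg_trans lim; apply: near_eq_cvg; near=> n.
have A0 : (0 < #|A n|)%N by near: n.
by rewrite /G; case: pselect => // {}A0; rewrite dens_induced.
Unshelve. all: by end_near. Qed.

(** If graphs approximating Gamma are split in two parts of nonvanishing mass
without edges between them, the limits of the two parts exhibit Gamma as a
direct sum. *)
Lemma connected_cut (A B : forall n, pred 'I_(nverts (S n))) (a mu : R)
    (Gamma : graph_limit R) :
  connected_limit Gamma -> 0 < a ->
  (forall n x y, B n x -> B n y -> adj x y -> A n x = A n y) ->
  mass (H := uniform (S n)) (B n) @[n --> U] --> a ->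
  mass (H := uniform (S n)) (predI (B n) (A n)) @[n --> U] --> mu ->
  (forall F, connected_graph F -> has_edge F ->
    dens F (H := uniform (S n)) (B n) @[n --> U] --> a ^+ nverts F * Gamma F) ->
  mu = 0 \/ mu = a.
Proof.
move=> cG a0 AB Ba Amu BG.
have mu0 : 0 <= mu.
  by apply: (cvgr_to_ge Amu); apply: nearW => n; exact: mass_ge0.
have Cmu : mass (H := uniform (S n)) (predI (B n) (predC (A n))) @[n --> U] -->
    a - mu.
  under eq_fun => n.
    rewrite (_ : mass _ = mass (H := uniform (S n)) (B n) -
      mass (H := uniform (S n)) (predI (B n) (A n))); first by over.
    by rewrite (@mass_cut R (uniform (S n)) (A n) (B n)) addrC addKr.
  exact: cvgB.
have mua : 0 <= a - mu.
  by apply: (cvgr_to_ge Cmu); apply: nearW => n; exact: mass_ge0.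
have [->|nmu0] := eqVneq mu 0; first by left.
have [->|nmua] := eqVneq mu a; first by right.
exfalso; apply: cG.
have mu_gt0 : 0 < mu by rewrite lt_def nmu0.
have mua_gt0 : 0 < a - mu by rewrite lt_def mua subr_eq0 eq_sym nmua.
have [D1 HD1] := restricted_limit Amu mu_gt0.
have [D2 HD2] := restricted_limit Cmu mua_gt0.
exists D1, D2, (mu / a); split.
  by rewrite divr_gt0 //= ltr_pdivrMr // mul1r -subr_gt0.
apply/is_direct_sum2P => [|F cF eF].
  by rewrite divr_ge0 ?ltW //= ltr_pdivrMr // mul1r -subr_gt0.
have an0 : a ^+ nverts F != 0 by rewrite expf_neq0 // gt_eqF.
have E : a ^+ nverts F * Gamma F =
    mu ^+ nverts F * D1 F + (a - mu) ^+ nverts F * D2 F.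
  apply: (cvg_unique _ (BG F cF eF)) => //=.
  under eq_fun => n do
    rewrite (@dens_cut R F (uniform (S n)) (A n) (B n) cF (AB n)).
  exact: cvgD.
apply: (mulfI an0); rewrite E mulrDr !mulrA -!exprMn.
congr (_ ^+ _ * _ + _ ^+ _ * _); first by field; rewrite gt_eqF.
by field; rewrite gt_eqF.
Qed.

Lemma zero_limit_disconnected (Gamma : graph_limit R) :
  (forall F, connected_graph F -> has_edge F -> Gamma F = 0) ->
  disconnected_limit Gamma.
Proof.
move=> G0; exists Gamma, Gamma, (1 / 2); split; first by apply/andP; split; lra.
apply/is_direct_sum2P => [|F cF eF]; first by apply/andP; split; lra.
by rewrite G0 // !mulr0 addr0.
Qed.

End Cuts.

Section LabelExcess.
Context {R : realType}.

Lemma mass_mono (H : wgraph R) (P Q : pred (vertex H)) :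
  (forall x, P x -> Q x) -> mass P <= mass Q.
Proof. by rewrite -!dens_vertex_graph; exact: dens_mono. Qed.

(** A homomorphism into A is either counted in one of the classes of X, or in the
excess of the total density over the densities of these classes. *)
Lemma dens_label_excess F (H : wgraph R) (J : eqType) (A : pred (vertex H))
    (lab : vertex H -> option J) (X : seq J) : uniq X ->
  dens F A <= \sum_(j <- X) dens F (predI A (sel lab (Some j))) +
    (dens F (H := H) predT - \sum_(j <- X) dens F (sel lab (Some j))).
Proof.
move=> uX; rewrite /dens -!expect_sum_seq -[- expect _ _]mulN1r -expectZ -!expectD.
apply: ler_expect => [x|f]; first exact: weight_ge0.
pose h P := hom_in (F := F) (@edge R H) P f.
have h_pred P : h P -> h predT.
  by move=> /hom_inP [h1 _]; apply/hom_inP.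
have h_sum0 : ~~ h predT -> \sum_(j <- X) (h (sel lab (Some j)))%:R = 0 :> R.
  move=> nh; rewrite big1 // => j _; case: (boolP (h _)) => // /h_pred.
  by rewrite (negPf nh).
have s0 : 0 <= \sum_(j <- X) (h (predI A (sel lab (Some j))))%:R :> R.
  by apply: sumr_ge0.
rewrite -/(h A) -/(h predT) mulN1r.
have [hT|nhT] := boolP (h predT); last first.
  rewrite h_sum0 // subr0 addr0.
  by case: (boolP (h A)) => [/h_pred|_ //]; rewrite (negPf nhT).
have [[j jX hj]|nj] := pselect (exists2 j, j \in X & h (sel lab (Some j))).
  have -> : \sum_(j <- X) (h (sel lab (Some j)))%:R = 1 :> R.
    rewrite (bigD1_seq j) //= hj big1 ?addr0 // => j' j'j.
    case: (boolP (h _)) => // /hom_inP [_ h2].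
    have /hom_inP [_ h3] := hj; pose o := Ordinal (nverts_gt0 F).
    have := h2 o; have := h3 o; rewrite /sel /= => /eqP -> /eqP [] E.
    by rewrite E eqxx in j'j.
  rewrite subrr addr0; case: (boolP (h A)) => // hA.
  rewrite (bigD1_seq j) //=.
  have hAj : hom_in (@edge R H) (predI A (sel lab (Some j))) f.
    move/hom_inP: hA => [h1 h2]; move/hom_inP: hj => [_ h3].
    by apply/hom_inP; split => // x /=; rewrite h2 h3.
  by rewrite hAj lerDl sumr_ge0.
rewrite [X in - X]big_seq_cond [X in - X]big1 ?subr0; last first.
  move=> j; rewrite andbT => jX; case: (boolP (hom_in _ _ f)) => // hj.
  by case: nj; exists j.
by rewrite -[leLHS]add0r lerD // ler_nat leq_b1.
Qed.
End LabelExcess.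

Section Matching.
Context {R : realType} {U : set_system nat} (UU : UltraFilter U).
Context (S : nat -> graph).
Hypothesis vS : forall N, \forall n \near U, (N <= nverts (S n))%N.
(** Two labellings of the same graphs come from two decompositions of Gamma, and
m i j is the limit mass of the vertices with labels i and j. *)
Context (I J : choiceType) (Gamma : graph_limit R).
Context (a : I -> R) (Gs : I -> graph_limit R) (b : J -> R) (Ds : J -> graph_limit R).
Hypothesis decb : decomposes Gamma b Ds.
Context (l : forall n, 'I_(nverts (S n)) -> option I).
Context (l' : forall n, 'I_(nverts (S n)) -> option J).
Hypothesis l'_resp : forall n, respects (@adj (S n)) (@l' n).
Hypothesis l_cvg : forall F o, dens F (H := uniform (S n)) (sel (@l n) o)
  @[n --> U] --> component_density Gamma a Gs F o.
Hypothesis l'_cvg : forall F o, dens F (H := uniform (S n)) (sel (@l' n) o)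
  @[n --> U] --> component_density Gamma b Ds F o.
Context (m : I -> J -> R).
Hypothesis m_cvg : forall i j, mass (H := uniform (S n))
  (predI (sel (@l n) (Some i)) (sel (@l' n) (Some j))) @[n --> U] --> m i j.

Lemma label_mass_cvg i :
  mass (H := uniform (S n)) (sel (@l n) (Some i)) @[n --> U] --> a i.
Proof.
under eq_fun do rewrite -dens_vertex_graph.
have := @l_cvg vertex_graph (Some i); rewrite /= expr1 graph_limit_noedge ?mulr1 //.
by case=> x [y].
Qed.

(** When m i j = a i, only a vanishing mass of the class i has another label
than j, and vanishing masses do not contribute to densities. *)
Lemma cut_cvg i j F : connected_graph F -> has_edge F -> m i j = a i ->
  dens F (H := uniform (S n)) (predI (sel (@l n) (Some i)) (sel (@l' n) (Some j)))
    @[n --> U] --> a i ^+ nverts F * Gs i F.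
Proof.
move=> cF eF mij.
have rest0 : dens F (H := uniform (S n)) (predI (sel (@l n) (Some i))
    (predC (sel (@l' n) (Some j)))) @[n --> U] --> (0 : R).
  apply: (@squeeze_cvgr _ _ _ _ (fun=> 0) (fun n =>
      mass (H := uniform (S n)) (sel (@l n) (Some i)) -
      mass (H := uniform (S n)) (predI (sel (@l n) (Some i)) (sel (@l' n) (Some j))))).
  - apply: nearW => n; rewrite dens_ge0 /=.
    rewrite (@mass_cut R (uniform (S n)) (sel (@l' n) (Some j)) (sel (@l n) (Some i))).
    by rewrite addrC addKr dens_le_mass.
  - exact: cvg_cst.
  - by rewrite -(subrr (a i)) -{2}mij; apply: cvgB => //; exact: label_mass_cvg.
have lim : dens F (H := uniform (S n)) (sel (@l n) (Some i)) -
   dens F (H := uniform (S n)) (predI (sel (@l n) (Some i))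
    (predC (sel (@l' n) (Some j)))) @[n --> U] --> a i ^+ nverts F * Gs i F - 0.
  by apply: cvgB => //; exact: l_cvg.
rewrite subr0 in lim; apply: cvg_trans lim; apply: near_eq_cvg; apply: nearW => n.
rewrite (@dens_cut R F (uniform (S n)) (sel (@l' n) (Some j))) ?addrK //.
by move=> x y _ _ /l'_resp; rewrite /sel => ->.
Qed.

(** The second labelling cuts the class i into the vertices labelled j and the
others, and no edge crosses this cut. *)
Lemma overlap_dichotomy i j : 0 < a i -> connected_limit (Gs i) ->
  m i j = 0 \/ m i j = a i.
Proof.
move=> ai ci; apply: (connected_cut UU vS ci ai _ (@label_mass_cvg i) (@m_cvg i j)).
  by move=> n x y _ _ /l'_resp; rewrite /sel => ->.
by move=> F cF eF; exact: l_cvg.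
Qed.

Lemma overlap_ge0 i j : 0 <= m i j.
Proof. by apply: (cvgr_to_ge (@m_cvg i j)); apply: nearW => n; exact: mass_ge0. Qed.

Lemma overlap_le i j : m i j <= a i.
Proof.
apply: (ler_cvg_to (@m_cvg i j) (@label_mass_cvg i)); apply: nearW => n.
rewrite (@mass_cut R (uniform (S n)) (sel (@l' n) (Some j)) (sel (@l n) (Some i))).
by rewrite lerDl mass_ge0.
Qed.

(** Two distinct labels of positive overlap would each fill the class i. *)
Lemma overlap_unique i j j' : 0 < a i -> connected_limit (Gs i) ->
  0 < m i j -> 0 < m i j' -> j = j'.
Proof.
move=> ai ci mj mj'; apply: contrapT => /eqP jj'.
have [E|E] := overlap_dichotomy j ai ci; first by rewrite E ltxx in mj.
have [E'|E'] := overlap_dichotomy j' ai ci; first by rewrite E' ltxx in mj'.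
suff : m i j + m i j' <= a i by rewrite E E' gerDl leNgt ai.
apply: (ler_cvg_to (cvgD (@m_cvg i j) (@m_cvg i j')) (@label_mass_cvg i)).
apply: nearW => n /=.
rewrite [leRHS](@mass_cut R (uniform (S n)) (sel (@l' n) (Some j)) (sel (@l n) (Some i))).
rewrite lerD2l; apply: mass_mono => x /= /andP[-> /=].
rewrite /sel /= => /eqP ->; apply/eqP => -[E''].
by rewrite E'' eqxx in jj'.
Qed.

(** A connected part of positive weight cannot be spread over infinitely many
labels of the other family with vanishing masses, as the total of the densities
of the labels outside a large finite set is small. *)
Lemma overlap_exists i : 0 < a i -> connected_limit (Gs i) ->
  exists j, 0 < m i j.
Proof.
move=> ai ci; apply: contrapT => nm.
have m0 j : m i j = 0.
  apply/eqP; rewrite eq_le overlap_ge0 andbT leNgt; apply/negP => mj.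
  by apply: nm; exists j.
apply: ci; apply: zero_limit_disconnected => F cF eF.
have d0 j : dens F (H := uniform (S n)) (predI (sel (@l n) (Some i))
    (sel (@l' n) (Some j))) @[n --> U] --> (0 : R).
  apply: (@squeeze_cvgr _ _ _ _ (fun=> 0) (fun n => mass (H := uniform (S n))
    (predI (sel (@l n) (Some i)) (sel (@l' n) (Some j))))).
  - by apply: nearW => n; rewrite dens_ge0 dens_le_mass.
  - exact: cvg_cst.
  - by rewrite -(m0 j); exact: m_cvg.
have ap : 0 < a i ^+ nverts F by rewrite exprn_gt0.
suff : a i ^+ nverts F * Gs i F <= 0.
  rewrite pmulr_rle0 // => le0; apply/eqP; rewrite eq_le le0.
  by case/andP: (graph_limit01 (Gs i) F).
apply/ler_addgt0Pr => e e0; rewrite add0r.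
have [_ _ totb] := decb; have [X uX ltX] := (totb F cF eF).2 e e0.
apply: (@le_trans _ _ (\sum_(j <- X) 0 +
    (Gamma F - \sum_(j <- X) b j ^+ nverts F * Ds j F))); last first.
  by rewrite big1 // add0r; lra.
have lim : \sum_(j <- X) dens F (H := uniform (S n)) (predI (sel (@l n) (Some i))
      (sel (@l' n) (Some j))) +
    (dens F (H := uniform (S n)) predT -
       \sum_(j <- X) dens F (H := uniform (S n)) (sel (@l' n) (Some j))) @[n --> U] -->
    \sum_(j <- X) 0 + (Gamma F - \sum_(j <- X) b j ^+ nverts F * Ds j F).
  apply: cvgD; first by apply: cvg_big => [|j _]; [exact: add_continuous|].
  apply: cvgB.
    by have := @l_cvg F None; under eq_fun do rewrite dens_sel_None.
  apply: cvg_big => [|j _]; first exact: add_continuous.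
  exact: (@l'_cvg F (Some j)).
apply: (ler_cvg_to (@l_cvg F (Some i)) lim); apply: nearW => n.
exact: dens_label_excess.
Qed.
End Matching.

(** * Uniqueness of the decomposition *)

Section Uniqueness.
Context {R : realType}.

Lemma mass_predIC (H : wgraph R) (P Q : pred (vertex H)) :
  mass (predI P Q) = mass (predI Q P).
Proof. by apply: eq_bigl => x; rewrite /= andbC. Qed.

Lemma mass_le1 (H : wgraph R) (P : pred (vertex H)) : mass P <= 1.
Proof. by rewrite -dens_vertex_graph dens_le1. Qed.

(** The relation rho holds between parts that overlap in a positive mass in graphs
approximating both decompositions. *)
Lemma matching (I J : countType) (Gamma : graph_limit R)
    (a : I -> R) (Gs : I -> graph_limit R)
    (b : J -> R) (Ds : J -> graph_limit R) :
  decomposes Gamma a Gs -> decomposes Gamma b Ds ->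
  exists rho : I -> J -> Prop,
    [/\ forall i, 0 < a i -> connected_limit (Gs i) ->
          exists2 j, rho i j & forall j', rho i j' -> j' = j,
        forall j, 0 < b j -> connected_limit (Ds j) ->
          exists2 i, rho i j & forall i', rho i' j -> i' = i,
        forall i j, rho i j -> 0 < a i /\ 0 < b j &
        forall i j, rho i j -> connected_limit (Gs i) ->
          connected_limit (Ds j) -> a i = b j /\ Gs i = Ds j].
Proof.
move=> deca decb.
have [H [lab Hlim]] := decomposition_limit deca.
have [H' [lab' H'lim]] := decomposition_limit decb.
have [|S [l [l' [vS [l_resp l_cvg] [l'_resp l'_cvg]]]]] := overlay Hlim H'lim.
  by [].
have [U [UU Uoo]] := free_ultrafilter.
have vU N : \forall n \near U, (N <= nverts (S n))%N by apply: Uoo; exact: vS.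
have lU F o : dens F (H := uniform (S n)) (sel (l n) o)
    @[n --> U] --> component_density Gamma a Gs F o.
  by apply: cvg_free Uoo _; exact: l_cvg.
have l'U F o : dens F (H := uniform (S n)) (sel (l' n) o)
    @[n --> U] --> component_density Gamma b Ds F o.
  by apply: cvg_free Uoo _; exact: l'_cvg.
pose m i j : R := lim (mass (H := uniform (S n))
  (predI (sel (l n) (Some i)) (sel (l' n) (Some j))) @[n --> U]).
have mU i j : mass (H := uniform (S n))
    (predI (sel (l n) (Some i)) (sel (l' n) (Some j))) @[n --> U] --> m i j.
  by apply: (bounded_ultra_cvg UU) => n; rewrite mass_ge0 mass_le1.
have mU' j i : mass (H := uniform (S n))
    (predI (sel (l' n) (Some j)) (sel (l n) (Some i))) @[n --> U] --> m i j.
  by under eq_fun do rewrite mass_predIC; exact: mU.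
have ma := overlap_le (Gs := Gs) UU lU mU.
have mb := overlap_le (m := fun j i => m i j) UU l'U mU'.
exists (fun i j => 0 < m i j); split.
- move=> i ai ci.
  have [j mij] := overlap_exists UU decb lU l'U mU ai ci.
  by exists j => // j' mij'; exact: (overlap_unique UU vU l'_resp lU mU ai ci).
- move=> j bj cj.
  have [i mij] := overlap_exists (m := fun j i => m i j)
    UU deca l'U lU mU' bj cj.
  exists i => // i' mij'.
  exact: (overlap_unique (m := fun j i => m i j) UU vU l_resp l'U mU' bj cj).
- by move=> i j mij; split; [exact: lt_le_trans (ma i j)|exact: lt_le_trans (mb j i)].
move=> i j mij ci cj.
have ai : 0 < a i by exact: lt_le_trans (ma i j).
have bj : 0 < b j by exact: lt_le_trans (mb j i).
have [E|Ea] := overlap_dichotomy UU vU l'_resp lU mU j ai ci.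
  by rewrite E ltxx in mij.
have [E|Eb] := overlap_dichotomy (m := fun j i => m i j) UU vU l_resp l'U mU' i bj cj.
  by rewrite E ltxx in mij.
have ab : a i = b j by rewrite -Ea -Eb.
split=> //; apply: graph_limit_determined => F cF eF.
have la := cut_cvg UU l'_resp lU mU cF eF Ea.
have lb := cut_cvg (m := fun j i => m i j) UU l_resp l'U mU' cF eF Eb.
have an0 : a i ^+ nverts F != 0 by rewrite expf_neq0 // gt_eqF.
apply: (mulfI an0); rewrite [in RHS]ab.
apply: (cvg_unique _ la) => //=; apply: cvg_trans lb.
apply: near_eq_cvg; apply: nearW => n; apply: eq_dens => x.
by rewrite /= andbC.
Qed.

(** In graphs approximating the direct sum, the complement of the class i has
mass tending to 1 - a i, and after normalisation it converges to Delta. If this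
mass vanishes, any graph limit will do for Delta. *)
Lemma component_complement (I : countType) (Gamma : graph_limit R)
    (a : I -> R) (Gs : I -> graph_limit R) i :
  decomposes Gamma a Gs -> exists Delta, is_direct_sum2 (a i) (Gs i) Delta Gamma.
Proof.
move=> dec; have ai1 := decomposes_le1 i dec; have [a0 _ _] := dec.
have [H [lab Hlim]] := decomposition_limit dec.
have [|S [l [_ [vS [l_resp l_cvg] _]]]] := overlay Hlim Hlim; first by [].
have [U [UU Uoo]] := free_ultrafilter.
have vU N : \forall n \near U, (N <= nverts (S n))%N by apply: Uoo; exact: vS.
have lU F o : dens F (H := uniform (S n)) (sel (l n) o)
    @[n --> U] --> component_density Gamma a Gs F o.
  by apply: cvg_free Uoo _; exact: l_cvg.
have massE n : mass (H := uniform (S n)) (predI predT (predC (sel (l n) (Some i)))) =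
    1 - mass (H := uniform (S n)) (sel (l n) (Some i)) :> R.
  rewrite -(mass_predT (uniform (S n))).
  rewrite (@mass_cut R (uniform (S n)) (sel (l n) (Some i)) predT).
  rewrite [X in _ = X + _ - _](_ : _ = mass (H := uniform (S n)) (sel (l n) (Some i))).
    by rewrite addrC addKr.
  exact: eq_bigl.
have rest : mass (H := uniform (S n)) (predI predT (predC (sel (l n) (Some i))))
    @[n --> U] --> 1 - a i.
  under eq_fun do rewrite massE; apply: cvgB; first exact: cvg_cst.
  exact: (label_mass_cvg lU).
have [Delta HD] : exists Delta : graph_limit R, forall F,
    dens F (H := uniform (S n)) (predI predT (predC (sel (l n) (Some i))))
      @[n --> U] --> (1 - a i) ^+ nverts F * Delta F.
  have [ai1'|/negPf nai1] := eqVneq (a i) 1; last first.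
    by apply: (restricted_limit UU vU rest); rewrite subr_gt0 lt_neqAle nai1.
  exists Gamma => F; rewrite ai1' subrr expr0n gtn_eqF ?nverts_gt0 // mul0r.
  apply: (@squeeze_cvgr _ _ _ _ (fun=> 0) (fun n => mass (H := uniform (S n))
      (predI predT (predC (sel (l n) (Some i)))))).
  - by apply: nearW => n; rewrite dens_ge0 dens_le_mass.
  - exact: cvg_cst.
  - by rewrite -(subrr 1) -{2}ai1'.
exists Delta; apply/is_direct_sum2P => [|F cF eF]; first by rewrite a0 ai1.
have lT := lU F None.
apply: (cvg_unique _ lT) => //=.
under eq_fun => n.
  rewrite dens_sel_None.
  rewrite (@dens_cut R F (uniform (S n)) (sel (l n) (Some i)) predT cF); last first.
    by move=> x y _ _ /l_resp; rewrite /sel => ->.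
  rewrite (@eq_dens R F (uniform (S n)) _ (sel (l n) (Some i))) //; over.
by apply: cvgD (HD F); exact: (lU F (Some i)).
Qed.

Lemma connected_decomposition_unique (I J : countType) (Gamma : graph_limit R)
    (a : I -> R) (Gs : I -> graph_limit R)
    (b : J -> R) (Ds : J -> graph_limit R) :
  decomposes Gamma a Gs -> decomposes Gamma b Ds ->
  (forall i, 0 < a i) -> (forall i, connected_limit (Gs i)) ->
  (forall j, 0 < b j) -> (forall j, connected_limit (Ds j)) ->
  exists sigma : I -> J, bijective sigma /\
    forall i, Ds (sigma i) = Gs i /\ b (sigma i) = a i.
Proof.
move=> deca decb a0 ca b0 cb.
have [rho [rhoI rhoJ _ rhoE]] := matching deca decb.
have /choice[s Hs] (i : I) : exists j, rho i j /\ forall j', rho i j' -> j' = j.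
  by have [j h1 h2] := rhoI i (a0 i) (ca i); exists j.
have /choice[t Ht] (j : J) : exists i, rho i j /\ forall i', rho i' j -> i' = i.
  by have [i h1 h2] := rhoJ j (b0 j) (cb j); exists i.
exists s; split.
  exists t => [i|j]; first by apply/esym/(Ht (s i)).2/(Hs i).1.
  by apply/esym/(Hs (t j)).2/(Ht j).1.
by move=> i; have [-> ->] := rhoE i (s i) (Hs i).1 (ca i) (cb _).
Qed.

Lemma component_iff (I : countType) (Gamma : graph_limit R)
    (a : I -> R) (Gs : I -> graph_limit R) (Gamma' : graph_limit R) :
  decomposes Gamma a Gs -> (forall i, 0 < a i) ->
  (forall i, connected_limit (Gs i)) ->
  is_component Gamma Gamma' <-> exists i, Gamma' = Gs i.
Proof.
move=> dec a0 ca; split=> [[c' [c [Delta [/andP[c0 c1] sum2]]]]|[i ->]]; last first.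
  split=> //; have [Delta sum2] := component_complement i dec.
  by exists (a i), Delta; split; rewrite // a0 (decomposes_le1 i dec).
pose b := tnth [tuple c; 1 - c]; pose Ds := tnth [tuple Gamma'; Delta].
have b00 : b ord0 = c by [].
have D00 : Ds ord0 = Gamma' by [].
have decb : @decomposes R 'I_2 Gamma b Ds.
  have b_ge0 i : 0 <= b i.
    by case: i => -[|[|//]] i2; rewrite /b (tnth_nth 0) /= ?subr_ge0 // ltW.
  split=> // [X uX|F cF eF]; last by apply/esum_has_total/esym/sum2.
  have [le1 _] := has_total_finite b_ge0.
  apply: le_trans (le1 X uX) _; rewrite big_ord_recl big_ord1 /b !(tnth_nth 0) /=.
  by rewrite addrC subrK.
have [rho [_ rhoJ _ rhoE]] := matching dec decb.
have [||i rhoi _] := rhoJ ord0; [by rewrite b00|by rewrite D00|].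
by exists i; have [_ ->] := rhoE i ord0 rhoi (ca i) c'.
Qed.
End Uniqueness.

(** * Existence of the decomposition *)

Section Existence.
Context {R : realType}.

(** The family f is moved along index_of, with partial inverse pick_of, and
extended by zeros; only the nonzero terms need to be moved injectively. *)
Section Reindexing.
Context (I J : choiceType) (f : I -> R) (g : J -> R).
Context (pick_of : J -> option I) (index_of : I -> J) (s : R).
Hypothesis pick_ofK : ocancel pick_of index_of.
Hypothesis gE : forall j, g j = oapp f 0 (pick_of j).
Hypothesis index_ofK : forall i, f i != 0 -> pick_of (index_of i) = Some i.

Lemma reindex_bounded : bounded_total f s -> bounded_total g s.
Proof.
move=> le_s Y uY; under eq_bigr do rewrite gE.
by rewrite -big_pmap; apply: le_s; exact: pmap_uniq pick_ofK _ uY.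
Qed.

Lemma reindex_total : has_total f s -> has_total g s.
Proof.
move=> [le_s gt_s]; split; first exact: reindex_bounded.
move=> e e0; have [X uX lt_s] := gt_s e e0.
exists (map index_of [seq i <- X | f i != 0]).
  rewrite map_inj_in_uniq ?filter_uniq // => i i'.
  rewrite !mem_filter => /andP[fi _] /andP[fi' _] E.
  by have := index_ofK fi; rewrite E index_ofK // => -[].
apply: lt_le_trans lt_s _; rewrite big_map big_filter [leRHS]big_mkcond /=.
apply: ler_sum => i _; case: (boolP (f i != 0)) => [fi|].
  by rewrite gE index_ofK.
by rewrite negbK => /eqP ->.
Qed.
End Reindexing.

Lemma finite_set_seq (T : choiceType) (A : set T) : finite_set A ->
  exists2 X : seq T, uniq X & forall x, x \in X <-> A x.
Proof.
move=> /finite_seqP[X ->]; exists (undup X); first exact: undup_uniq.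
by move=> x; rewrite mem_undup.
Qed.

(** In a summable family sorted in decreasing order, the term of rank k is at
most 1 / (k + 1) of the total. *)
Lemma decreasing_rank (I : countType) (a : I -> R) :
  (forall i, 0 <= a i) -> bounded_total a 1 ->
  exists r : I -> nat,
    (forall i j, 0 < a i -> 0 < a j -> r i = r j -> i = j) /\
    forall i, 0 < a i -> a i <= (r i).+1%:R^-1.
Proof.
move=> a0 a1.
pose before i j := a i < a j \/ a i = a j /\ (pickle j < pickle i)%N.
have fin_before i : 0 < a i -> finite_set (before i).
  move=> ai; apply: contrapT => /infinite_set_fset inf.
  have [B /= Bi cB] := inf (Num.truncn (a i)^-1).+1.
  have := a1 _ (finmap.fset_uniq B).
  rewrite leNgt => /negP; apply.
  have lt1 : 1 < \sum_(j <- finmap.enum_fset B) a i.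
    rewrite big_const_seq count_predT iter_addr addr0 -[ltRHS]mulr_natl.
    rewrite -ltr_pdivrMr // div1r; apply: lt_le_trans (truncnS_gt _) _.
    by rewrite ler_nat.
  apply: lt_le_trans lt1 _.
  rewrite big_seq [leRHS]big_seq; apply: ler_sum => j jB.
  by have [/ltW|[-> _]] := Bi j jB.
have /choice[X HX] (i : I) : exists X : seq I,
    uniq X /\ (0 < a i -> forall j, j \in X <-> before i j).
  have [ai|nai] := boolP (0 < a i); last by exists [::].
  by have [X uX h] := finite_set_seq (fin_before i ai); exists X.
exists (fun i => size (X i)); split=> [i j ai aj E|i ai].
  have lt_size k l : 0 < a k -> 0 < a l -> before l k -> (size (X k) < size (X l))%N.
    move=> ak al lk; have [uk hk] := HX k; have [ul hl] := HX l.
    have : uniq (k :: X k).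
      rewrite /= uk andbT; apply/negP => /(hk ak k).
      by case=> [|[_]]; rewrite ?ltxx ?ltnn.
    move=> /uniq_leq_size -> // z; rewrite inE => /orP[/eqP ->|].
      exact/(hl al k).
    move=> /(hk ak z) kz; apply/(hl al z).
    case: lk kz => [lk|[elk plk]] [kz|[ekz pkz]].
    - by left; exact: lt_trans kz.
    - by left; rewrite -ekz.
    - by left; rewrite elk.
    - by right; rewrite elk; split=> //; exact: ltn_trans plk.
  have [aij|aij|aij] := ltgtP (a i) (a j).
  - by have := lt_size j i aj ai (or_introl aij); rewrite E ltnn.
  - by have := lt_size i j ai aj (or_introl aij); rewrite E ltnn.
  have [pij|pij|pij] := ltngtP (pickle i) (pickle j).
  - by have := lt_size i j ai aj (or_intror (conj (esym aij) pij)); rewrite E ltnn.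
  - by have := lt_size j i aj ai (or_intror (conj aij pij)); rewrite E ltnn.
  exact: (pcan_inj pickleK).
have [uX hX] := HX i.
have u : uniq (i :: X i).
  rewrite /= uX andbT; apply/negP => /(hX ai i).
  by case=> [|[_]]; rewrite ?ltxx ?ltnn.
have := a1 _ u; rewrite big_cons => le1.
rewrite -[leRHS]div1r ler_pdivlMr ?ltr0n // mulr_natr mulrS.
apply: le_trans le1; rewrite lerD2l.
apply: (@le_trans _ _ (\sum_(j <- X i) a i)).
  by rewrite big_const_seq count_predT iter_addr addr0.
rewrite big_seq [leRHS]big_seq; apply: ler_sum => j jX.
by have [/ltW|[-> _]] := (hX ai j).1 jX.
Qed.

(** Any decomposition can be indexed by natural numbers with weights at most
1 / (k + 1), which controls the weights independently of the decomposition; q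
bounds the sum of the squared weights. *)
Lemma sorted_decomposition (I : countType) (Gamma : graph_limit R) (a : I -> R)
    (Gs : I -> graph_limit R) (q : R) :
  decomposes Gamma a Gs -> bounded_total (fun i => a i ^+ 2) q ->
  exists (b : nat -> R) (Ds : nat -> graph_limit R),
    [/\ decomposes Gamma b Ds, bounded_total (fun i => b i ^+ 2) q &
        forall k, b k <= k.+1%:R^-1].
Proof.
move=> [a0 a1 tot] aq; have [r [r_inj r_le]] := decreasing_rank a0 a1.
have /choice[p Hp] (k : nat) : exists o : option I,
    (forall i, o = Some i -> 0 < a i /\ r i = k) /\
    (o = None -> forall i, 0 < a i -> r i <> k).
  have [[i [ai ri]]|n] := pselect (exists i, 0 < a i /\ r i = k).
    by exists (Some i); split=> // j [<-].
  by exists None; split=> // _ i ai ri; apply: n; exists i.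
have pK : ocancel p r.
  by move=> k; case E : (p k) => [i|] //=; have [/(_ i E)[]] := Hp k.
have rK i : 0 < a i -> p (r i) = Some i.
  move=> ai; case E : (p (r i)) => [j|].
    by have [/(_ j E)[aj rj] _] := Hp (r i); rewrite (r_inj j i).
  by have [_ /(_ E i ai)] := Hp (r i).
have rKn (h : I -> R) i : (a i = 0 -> h i = 0) -> h i != 0 -> p (r i) = Some i.
  move=> h0 hi; apply: rK; rewrite lt_def a0 andbT.
  by apply: contraNN hi => /eqP /h0 ->.
exists (fun k => oapp a 0 (p k)), (fun k => oapp Gs Gamma (p k)); split.
- split=> [k||F cF eF].
  + by case: (p k) => [i|] /=.
  + by apply: (reindex_bounded pK _ a1).
  + apply: (reindex_total pK _ _ (tot F cF eF)).
      move=> k; case: (p k) => [i|] //=; rewrite expr0n gtn_eqF ?mul0r //.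
      exact: nverts_gt0.
    move=> i; apply: (rKn (fun i => a i ^+ nverts F * Gs i F)) => ->; rewrite expr0n gtn_eqF ?mul0r //.
    exact: nverts_gt0.
- apply: (reindex_bounded pK _ aq).
  by move=> k; case: (p k) => [i|] //=; rewrite expr0n.
- move=> k; case E : (p k) => [i|] /=; last by rewrite invr_ge0.
  by have [/(_ i E)[ai <-] _] := Hp k; exact: r_le.
Qed.

Lemma has_edge_nverts F : has_edge F -> (1 < nverts F)%N.
Proof.
move=> [x [y xy]]; rewrite ltnNge; apply/negP => le1.
have E : x = y.
  apply: val_inj => /=; have := ltn_ord x; have := ltn_ord y; lia.
by move: xy; rewrite E adj_irrefl.
Qed.

(** Small parts contribute little to the densities of graphs with an edge, as
they enter at least quadratically. *)
Lemma sorted_tail (Gamma : graph_limit R) (a : nat -> R)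
    (Gs : nat -> graph_limit R) F n :
  decomposes Gamma a Gs -> (forall k, a k <= k.+1%:R^-1) ->
  connected_graph F -> has_edge F ->
  Gamma F <= \sum_(k < n) a k ^+ nverts F * Gs k F + n.+1%:R^-1.
Proof.
move=> dec ak cF eF; have [a0 a1 tot] := dec.
apply/ler_addgt0Pr => e e0; have [X uX ltX] := (tot F cF eF).2 e e0.
rewrite -lerBlDr; apply: le_trans (ltW ltX) _.
have f0 k : 0 <= a k ^+ nverts F * Gs k F.
  by rewrite mulr_ge0 ?exprn_ge0 //; case/andP: (graph_limit01 (Gs k) F).
rewrite (bigID (fun k => (k < n)%N)) /= lerD //.
  rewrite -(big_mkord predT (fun k => a k ^+ nverts F * Gs k F)) -big_filter.
  apply: ler_sum_subset; rewrite ?filter_uniq ?iota_uniq // => k.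
  by rewrite mem_filter mem_index_iota /= => /andP[].
apply: (@le_trans _ _ (\sum_(k <- X | ~~ (k < n)%N) a k * n.+1%:R^-1)).
  apply: ler_sum => k; rewrite -leqNgt => nk.
  apply: (@le_trans _ _ (a k ^+ nverts F)).
    by rewrite ler_piMr ?exprn_ge0 //; case/andP: (graph_limit01 (Gs k) F).
  apply: (@le_trans _ _ (a k ^+ 2)).
    apply: ler_wiXn2l (has_edge_nverts eF) => //; exact: decomposes_le1 dec.
  rewrite expr2 ler_wpM2l //; apply: le_trans (ak k) _.
  by rewrite lef_pV2 ?posrE ?ltr0n // ler_nat.
rewrite -mulr_suml ler_piMl ?invr_ge0 //.
by rewrite -big_filter; apply: a1; exact: filter_uniq.
Qed.

(** Sorted decompositions form a compact set: the tails are uniformly small. *)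
Lemma limit_decomposition (U : set_system nat) (UU : UltraFilter U)
    (Gamma : graph_limit R) (a : nat -> nat -> R)
    (Gs : nat -> nat -> graph_limit R) :
  (forall n, decomposes Gamma (a n) (Gs n)) ->
  (forall n k, a n k <= k.+1%:R^-1) ->
  exists (b : nat -> R) (Ds : nat -> graph_limit R),
    decomposes Gamma b Ds /\ forall k, a n k @[n --> U] --> b k.
Proof.
move=> dec ak.
have a01 n k : 0 <= a n k <= 1.
  by rewrite (decomposes_le1 k (dec n)) andbT; have [] := dec n.
pose b k := lim (a n k @[n --> U]).
have ab k : a n k @[n --> U] --> b k by exact: bounded_ultra_cvg.
pose t k F := lim (Gs n k F @[n --> U]).
have Gt k F : Gs n k F @[n --> U] --> t k F.
  by apply: bounded_ultra_cvg => n; exact: graph_limit01.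
have Lt k : is_graph_limit (t k) by exact: cvg_graph_limit (Gt k).
exists b, (fun k => GraphLimit (Lt k)); split => //.
have term_cvg k F : a n k ^+ nverts F * Gs n k F @[n --> U] -->
    b k ^+ nverts F * t k F by apply: cvgM (Gt k F); exact: cvgXn.
split=> [k|X uX|F cF eF].
- by apply: (cvgr_to_ge (ab k)); apply: nearW => n; case/andP: (a01 n k).
- have lim : \sum_(k <- X) a n k @[n --> U] --> \sum_(k <- X) b k.
    by apply: cvg_big => [|k _]; [exact: add_continuous|exact: ab].
  apply: (cvgr_to_le lim); apply: nearW => n; have [_ a1 _] := dec n.
  exact: a1.
split=> [X uX|e e0].
  have lim : \sum_(k <- X) a n k ^+ nverts F * Gs n k F @[n --> U] -->
      \sum_(k <- X) b k ^+ nverts F * t k F.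
    by apply: cvg_big => [|k _]; [exact: add_continuous|exact: term_cvg].
  apply: (cvgr_to_le lim); apply: nearW => n.
  by have [_ _ /(_ F cF eF)[le _]] := dec n; exact: le.
pose n := Num.truncn e^-1.
exists (iota 0 n); first exact: iota_uniq.
rewrite ltrBlDr; apply: (@le_lt_trans _ _
    (\sum_(k < n) b k ^+ nverts F * t k F + n.+1%:R^-1)); last first.
  rewrite -(big_mkord predT (fun k => b k ^+ nverts F * t k F)) /index_iota subn0.
  by rewrite ltrD2l invf_plt ?posrE ?ltr0n // truncnS_gt.
have lim : \sum_(k < n) a m k ^+ nverts F * Gs m k F + n.+1%:R^-1 @[m --> U] -->
    \sum_(k < n) b k ^+ nverts F * t k F + n.+1%:R^-1.
  apply: cvgD; last exact: cvg_cst.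
  by apply: cvg_big => [|k _]; [exact: add_continuous|exact: term_cvg].
apply: (cvgr_to_ge lim); apply: nearW => m.
exact: sorted_tail.
Qed.

(** A term f k is replaced by two terms g None and g (Some k), at a loss d. *)
Section SplitSum.
Context (f : nat -> R) (g : option nat -> R) (k : nat) (d : R).
Hypotheses (g0 : forall o, 0 <= g o) (gk : g None + g (Some k) = f k - d).
Hypothesis gf : forall j, j != k -> g (Some j) = f j.

Lemma split_sum (Y : seq nat) : uniq Y -> k \in Y ->
  \sum_(o <- None :: map Some Y) g o = \sum_(j <- Y) f j - d.
Proof.
move=> uY kY; rewrite big_cons big_map (bigD1_seq k) //= addrA gk.
rewrite [in RHS](bigD1_seq k) //= addrAC; congr (_ + _ - _).
by apply: eq_bigr => j; exact: gf.
Qed.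

Lemma split_bounded s : bounded_total f s -> bounded_total g (s - d).
Proof.
move=> fs X uX; pose Y := undup (k :: pmap id X).
have uY : uniq Y by exact: undup_uniq.
have kY : k \in Y by rewrite mem_undup inE eqxx.
apply: (@le_trans _ _ (\sum_(o <- None :: map Some Y) g o)).
  apply: ler_sum_subset => //.
    by rewrite /= (map_inj_uniq Some_inj) uY andbT; apply/mapP => -[].
  move=> [j|] jX; rewrite inE //=; apply/mapP; exists j => //.
  by rewrite mem_undup inE mem_pmap map_id jX orbT.
by rewrite split_sum // lerD2r fs.
Qed.

Lemma split_total s : d = 0 -> (forall j, 0 <= f j) ->
  has_total f s -> has_total g s.
Proof.
move=> d0 f0 [le_s gt_s]; split=> [X uX|e e0].
  by have := split_bounded le_s uX; rewrite d0 subr0.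
have [X uX lt_s] := gt_s e e0; pose Y := undup (k :: X).
have uY : uniq Y by exact: undup_uniq.
have kY : k \in Y by rewrite mem_undup inE eqxx.
exists (None :: map Some Y).
  by rewrite /= (map_inj_uniq Some_inj) uY andbT; apply/mapP => -[].
rewrite split_sum // d0 subr0; apply: lt_le_trans lt_s _.
apply: ler_sum_subset => // j jX.
by rewrite mem_undup inE jX orbT.
Qed.
End SplitSum.

(** Splitting a weight x into c x and (1 - c) x lowers the sum of squares by
2 c (1 - c) x ^ 2. *)
Lemma split_decomposition (Gamma : graph_limit R) (a : nat -> R)
    (Gs : nat -> graph_limit R) (k : nat) (q : R) :
  decomposes Gamma a Gs -> bounded_total (fun i => a i ^+ 2) q ->
  0 < a k -> disconnected_limit (Gs k) ->
  exists (b : option nat -> R) (Ds : option nat -> graph_limit R) (d : R),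
    [/\ 0 < d, decomposes Gamma b Ds & bounded_total (fun i => b i ^+ 2) (q - d)].
Proof.
move=> [a0 a1 tot] aq ak [D1 [D2 [c [/andP[c0 c1]]]]].
move/is_direct_sum2P => sum2; have {sum2} E := sum2 _.
pose b (o : option nat) := match o with
  | Some j => if j == k then a k * c else a j | None => a k * (1 - c) end.
pose Ds (o : option nat) := match o with
  | Some j => if j == k then D1 else Gs j | None => D2 end.
have b0 o : 0 <= b o.
  case: o => [j|] /=; last by rewrite mulr_ge0 // subr_ge0 ltW.
  by case: eqP => // _; rewrite mulr_ge0 // ltW.
exists b, Ds, (2 * c * (1 - c) * a k ^+ 2); split.
- by rewrite !mulr_gt0 ?exprn_gt0 ?subr_gt0.
- split=> // [|F cF eF].
    rewrite -[1]subr0.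
    apply: (split_bounded (f := a) (k := k)) => //.
      by rewrite /b eqxx subr0; ring.
    by move=> j /negPf jk; rewrite /b jk.
  apply: (split_total (k := k) (d := 0) _ _ _ _ _ (tot F cF eF)) => //.
  + move=> o; rewrite mulr_ge0 ?exprn_ge0 //.
    by case/andP: (graph_limit01 (Ds o) F).
  + rewrite /b /Ds eqxx E // ?c0 ?ltW // subr0 !exprMn; ring.
  + by move=> j /negPf jk; rewrite /b /Ds jk.
  + move=> j; rewrite mulr_ge0 ?exprn_ge0 //.
    by case/andP: (graph_limit01 (Gs j) F).
- apply: (split_bounded (k := k) _ _ _ aq) => [u| |j /negPf jk]; first exact: sqr_ge0.
    by rewrite /b eqxx; ring.
  by rewrite /b jk.
Qed.

(** By compactness there is a decomposition whose sum of squared weights is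
minimal. Its parts are connected, since splitting a disconnected part would
lower the sum. *)
Lemma minimal_decomposition (Gamma : graph_limit R) :
  exists (a : nat -> R) (Gs : nat -> graph_limit R),
    decomposes Gamma a Gs /\ forall k, 0 < a k -> connected_limit (Gs k).
Proof.
pose E : set R := [set q | exists (a : nat -> R) (Gs : nat -> graph_limit R),
  [/\ decomposes Gamma a Gs, bounded_total (fun i => a i ^+ 2) q &
      forall k, a k <= k.+1%:R^-1]].
have hasE : has_inf E.
  split; last first.
    by exists 0 => q [a [Gs [_ aq _]]]; have := aq [::] isT; rewrite big_nil.
  have le1 (X : seq unit) : uniq X -> \sum_(i <- X) 1 <= 1 :> R.
    move=> uX; rewrite -[leRHS](big_seq1 +%R tt (fun _ => 1)).
    by apply: ler_sum_subset => // -[]; rewrite inE.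
  have dec : @decomposes R unit Gamma (fun=> 1) (fun=> Gamma).
    split=> // F cF eF; split=> [X uX|e e0].
      apply: le_trans (_ : \sum_(i <- [:: tt]) Gamma F <= _); last by rewrite big_seq1.
      under eq_bigr do rewrite expr1n mul1r.
      apply: ler_sum_subset; [exact: uX|by []|by move=> [] _; rewrite inE|].
      by move=> _; case/andP: (graph_limit01 Gamma F).
    exists [:: tt] => //; rewrite big_seq1 expr1n mul1r; lra.
  have [|b [Ds h]] := sorted_decomposition (q := 1) dec.
    by move=> X uX; under eq_bigr do rewrite expr1n; exact: le1.
  by exists 1, b, Ds.
have /choice[a /choice[Gs HaG]] (n : nat) : exists (a : nat -> R) (Gs : nat -> graph_limit R),
  [/\ decomposes Gamma a Gs, bounded_total (fun i => a i ^+ 2) (inf E + n.+1%:R^-1) &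
      forall k, a k <= k.+1%:R^-1].
  have n0 : 0 < n.+1%:R^-1 :> R by rewrite invr_gt0.
  have [q [a [Gs [h1 h2 h3]]] lt_q] := inf_adherent n0 hasE.
  by exists a, Gs; split=> // X uX; exact: le_trans (h2 X uX) (ltW lt_q).
have [U [UU Uoo]] := free_ultrafilter.
have [b [Ds [decb ab]]] := limit_decomposition UU
  (fun n => let: And3 h _ _ := HaG n in h) (fun n => let: And3 _ _ h := HaG n in h).
exists b, Ds; split=> // k bk dk.
have bE : bounded_total (fun i => b i ^+ 2) (inf E).
  move=> X uX.
  have lim : \sum_(k <- X) a n k ^+ 2 @[n --> U] --> \sum_(k <- X) b k ^+ 2.
    by apply: cvg_big => [|j _]; [exact: add_continuous|exact: cvgXn].
  have lim' : inf E + n.+1%:R^-1 @[n --> U] --> inf E + 0.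
    by apply: cvg_free Uoo _; apply: cvgD; [exact: cvg_cst|exact: cvg_harmonic].
  rewrite addr0 in lim'.
  apply: (ler_cvg_to lim lim'); apply: nearW => n.
  by have [_ h _] := HaG n; exact: h.
have [b' [Ds' [d [d0 decb' b'E]]]] := split_decomposition decb bE bk dk.
have [b'' [Ds'' h]] := sorted_decomposition decb' b'E.
have : inf E <= inf E - d by apply: ge_inf; [exact: hasE.2|exists b'', Ds''].
by rewrite lerDl oppr_ge0 leNgt d0.
Qed.

Lemma enumerate_nat_set (P : set nat) :
  exists (M : option nat) (e : seq_index M -> nat),
    injective e /\ forall k, P k <-> exists i, e i = k.
Proof.
have [finP|infP] := pselect (finite_set P).
  have [X uX XP] := finite_set_seq finP.
  exists (Some (size X)), (fun i : 'I_(size X) => nth 0%N X i); split=> [i j /eqP|k].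
    by rewrite nth_uniq // => /eqP/val_inj.
  rewrite -XP; split=> [kX|[i <-]]; last exact: mem_nth.
  have kX' : (index k X < size X)%N by rewrite index_mem.
  by exists (Ordinal kX'); rewrite /= nth_index.
have /card_set_bijP[e [eP e_inj e_surj]] : ([set: nat] #= P)%card.
  by apply/card_esym/eq_card_nat.
exists None, e; split=> [i j ij|k].
  by apply: e_inj => //; exact: in_setT.
split=> [/e_surj[i _ <-]|[i <-]]; first by exists i.
exact: eP.
Qed.

Lemma subfamily_total (J : choiceType) (f : nat -> R) (e : J -> nat) (s : R) :
  injective e -> (forall k, f k != 0 -> exists i, e i = k) ->
  has_total f s -> has_total (fun i => f (e i)) s.
Proof.
move=> e_inj fe [le_s gt_s].
have /choice[p Hp] (k : nat) : exists o : option J,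
    oapp e k o = k /\ oapp (fun i => f (e i)) 0 o = f k.
  have [fk|/fe[i ei]] := eqVneq (f k) 0; first by exists None; rewrite /= fk.
  by exists (Some i); rewrite /= ei.
split=> [X uX|d d0].
  by rewrite -(big_map e predT f); apply: le_s; rewrite map_inj_uniq.
have [X uX lt_s] := gt_s d d0.
exists (pmap p X); first by apply: (pmap_uniq (g := e)) => // k; exact: (Hp k).1.
by rewrite big_pmap; under eq_bigr do rewrite (Hp _).2.
Qed.

Lemma connected_decomposition_exists (Gamma : graph_limit R) :
  exists (M : option nat) (alpha : seq_index M -> R)
    (Gammas : seq_index M -> graph_limit R),
    is_connected_decomposition Gamma alpha Gammas.
Proof.
have [a [Gs [[a0 a1 tot] cG]]] := minimal_decomposition Gamma.
have [M [e [e_inj eP]]] := enumerate_nat_set [set k | 0 < a k].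
have ae i : 0 < a (e i) by apply/(eP (e i)); exists i.
exists M, (fun i => a (e i)), (fun i => Gs (e i)); split=> //.
- by move=> i; exact: cG.
- apply/esum_leP => X uX.
  by rewrite -(big_map e predT a); apply: a1; rewrite map_inj_uniq.
move=> F cF eF; apply/esym/esum_has_total.
apply: (subfamily_total (f := fun k => a k ^+ nverts F * Gs k F)) => // [k|].
  move=> fk; apply/(eP k); rewrite /= lt_def a0 andbT.
  apply: contraNN fk => /eqP ->; rewrite expr0n gtn_eqF ?mul0r //.
  exact: nverts_gt0.
exact: tot.
Qed.
End Existence.

(** * The decomposition theorem *)

Section Final.
Context {R : realType}.

Lemma connected_decompositionP (M : option nat) (Gamma : graph_limit R)
    (alpha : seq_index M -> R) (Gammas : seq_index M -> graph_limit R) :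
  is_connected_decomposition Gamma alpha Gammas ->
  [/\ decomposes Gamma alpha Gammas, forall i, 0 < alpha i &
      forall i, connected_limit (Gammas i)].
Proof.
move=> [cG a0 a1 sumG]; split=> //; split=> [i|X|F cF eF]; first exact: ltW.
  by move: X; apply/esum_leP.
by apply/esum_has_total/esym/sumG.
Qed.

Lemma nat_ord_not_inj m (s : nat -> 'I_m) : ~ injective s.
Proof.
move=> s_inj; have : injective (fun i : 'I_m.+1 => s i).
  by move=> i j /s_inj/val_inj.
by move=> /leq_card; rewrite !card_ord ltnn.
Qed.

Lemma seq_index_inj (M M' : option nat) (s : seq_index M -> seq_index M') :
  bijective s -> M = M'.
Proof.
case: M M' s => [m|] [m'|] //= s bs.
- by congr Some; have := bij_eq_card bs; rewrite !card_ord.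
- by case: bs => t _ tK; case: (nat_ord_not_inj (can_inj tK)).
- by case: bs => t sK _; case: (nat_ord_not_inj (can_inj sK)).
Qed.

Lemma decomposition_unique (M M' : option nat) (Gamma : graph_limit R)
    (alpha : seq_index M -> R) (Gammas : seq_index M -> graph_limit R)
    (alpha' : seq_index M' -> R) (Gammas' : seq_index M' -> graph_limit R) :
  is_connected_decomposition Gamma alpha Gammas ->
  is_connected_decomposition Gamma alpha' Gammas' ->
  exists sigma : seq_index M -> seq_index M', bijective sigma /\
    forall i, Gammas' (sigma i) = Gammas i /\ alpha' (sigma i) = alpha i.
Proof.
move=> /connected_decompositionP[dec a0 cG] /connected_decompositionP[dec' a0' cG'].
case: M alpha Gammas dec a0 cG => [m|] alpha Gammas dec a0 cG;
case: M' alpha' Gammas' dec' a0' cG' => [m'|] alpha' Gammas' dec' a0' cG'.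
- exact: (@connected_decomposition_unique R 'I_m 'I_m' _ _ _ _ _ dec dec').
- exact: (@connected_decomposition_unique R 'I_m nat _ _ _ _ _ dec dec').
- exact: (@connected_decomposition_unique R nat 'I_m' _ _ _ _ _ dec dec').
- exact: (@connected_decomposition_unique R nat nat _ _ _ _ _ dec dec').
Qed.
End Final.

Theorem theorem1p5 (R : realType) (Gamma : graph_limit R) :
  (exists (M : option nat) (alpha : seq_index M -> R)
      (Gammas : seq_index M -> graph_limit R),
    is_connected_decomposition Gamma alpha Gammas) /\
  (forall (M M' : option nat)
      (alpha : seq_index M -> R) (Gammas : seq_index M -> graph_limit R)
      (alpha' : seq_index M' -> R) (Gammas' : seq_index M' -> graph_limit R),
    is_connected_decomposition Gamma alpha Gammas ->
    is_connected_decomposition Gamma alpha' Gammas' ->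
    M = M' /\
    exists sigma : seq_index M -> seq_index M',
      bijective sigma /\
      (forall i, Gammas' (sigma i) = Gammas i /\ alpha' (sigma i) = alpha i)) /\
  (forall (M : option nat)
      (alpha : seq_index M -> R) (Gammas : seq_index M -> graph_limit R),
    is_connected_decomposition Gamma alpha Gammas ->
    forall Gamma' : graph_limit R,
      is_component Gamma Gamma' <-> exists i, Gamma' = Gammas i).
Proof.
split; first exact: connected_decomposition_exists.
split=> [M M' alpha Gammas alpha' Gammas' dec dec'|M alpha Gammas dec Gamma'].
  have [sigma [bij_sigma E]] := decomposition_unique dec dec'.
  by split; [exact: seq_index_inj bij_sigma|exists sigma].
have [{}dec a0 cG] := connected_decompositionP dec.
case: M alpha Gammas dec a0 cG => [m|] alpha Gammas dec a0 cG.
  exact: (@component_iff R 'I_m _ _ _ _ dec a0 cG).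
exact: (@component_iff R nat _ _ _ _ dec a0 cG).
Qed.
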